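(* (a) For every real $\alpha\le -1$, $\mathcal{M}_\alpha\subset\mathcal{U}$. (b) For every $\alpha$ with $0\le\alpha\le 1$, $\mathcal{M}_\alpha$ is not a subset of $\mathcal{U}$.
   Context: Let $\mathbb{D}=\{z\in\mathbb{C}:|z|<1\}$ and let $\mathcal{A}$ be the family of functions $f$ analytic in $\mathbb{D}$ with $f(0)=0$, $f'(0)=1$. The class $\mathcal{U}$ consists of all $f\in\mathcal{A}$ such that $\left|\left[\frac{z}{f(z)}\right]^2 f'(z)-1\right|<1$ for all $z\in\mathbb{D}$. For real $\alpha$, the class $\mathcal{M}_\alpha$ of $\alpha$-convex functions consists of all $f\in\mathcal{A}$ with $\frac{f(z)f'(z)}{z}\ne 0$ for $z\in\mathbb{D}$ and $$\operatorname{Re}\left\{(1-\alpha)\frac{zf'(z)}{f(z)}+\alpha\left[1+\frac{zf''(z)}{f'(z)}\right]\right\}>0\quad (z\in\mathbb{D}).$$ *)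

(* Defs.v *)
(* complex numbers are R[i] (real_closed's complex)
   over an arbitrary R : realType, viewed as a normed module over itself
   ((R[i])^o), so that [derivable f z 1] / ['D_1 f z] is the COMPLEX derivative. *)
From mathcomp Require Import all_boot all_order all_algebra.
From mathcomp Require Import all_classical all_reals all_analysis.
From mathcomp Require Export complex.
Export Order.TTheory GRing.Theory Num.Theory ComplexField.
Export numFieldNormedType.Exports.

Set Implicit Arguments.
Unset Strict Implicit.
Unset Printing Implicit Defensive.

Local Open Scope ring_scope.

Definition Cplx (R : realType) := ((R[i])^o).

Section Defs.
Variable R : realType.
Local Notation C := (Cplx R).

Definition in_disc (z : C) : Prop := `|z| < 1.

Definition analytic_in_disc (f : C -> C) : Prop :=
  forall z : C, in_disc z -> derivable f z 1.

Definition classA (f : C -> C) : Prop :=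
  analytic_in_disc f /\ f 0 = 0 /\ 'D_1 f 0 = 1.

(* the class U.  The function z/f(z) is understood (as usual) as the
   analytic function on D with value 1 at z = 0; hence f(z) <> 0 for z <> 0
   is part of the requirement, and at z = 0 the inequality reads |1*1-1| < 1,
   which holds automatically, so only z <> 0 is quantified. *)
Definition classU (f : C -> C) : Prop :=
  classA f /\
  forall z : C, in_disc z -> z != 0 ->
    f z != 0 /\ `|(z / f z) ^+ 2 * 'D_1 f z - 1| < 1.

(* the class M_alpha of alpha-convex functions.  At z = 0 the quantity
   f(z)f'(z)/z equals f'(0)^2 = 1 and zf'(z)/f(z) equals 1 (removable
   singularities), so both conditions hold automatically at z = 0 and only
   z <> 0 is quantified. *)
Definition alpha_convex (alpha : R) (f : C -> C) : Prop :=
  classA f /\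
  (forall z : C, in_disc z -> z != 0 -> f z * 'D_1 f z / z != 0) /\
  (forall z : C, in_disc z -> z != 0 ->
     0 < Re ((1 - ((alpha%:C)%C : C)) * (z * 'D_1 f z / f z)
             + ((alpha%:C)%C : C) * (1 + z * 'D_1 ('D_1 f) z / 'D_1 f z))).

End Defs.

(* Main.v *)
(* Part (a).  With q = z / f and p = q - z q' = (z / f)^2 f', s = z f' / f = p / q,
   the functional in the definition of M_alpha equals both s + alpha z s' / s and
   (1 + alpha) s + alpha z p' / p - alpha.  At a first point where Re s = 0 the
   number z s' is real, so the first form is imaginary there: hence Re s > 0.
   Since p' = - z q'', the function p - 1 vanishes to order two at 0, so at a
   first point where |p - 1| = 1 Jack's lemma gives z p' = k (p - 1) with k >= 2,
   whence Re (z p' / p) = k / 2 >= 1 and the second form has real part <= 0.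

   Part (b).  For f = 2 (1 - u) with u = sqrt (1 - z), z f' / f = (1 + 1 / u) / 2 and
   1 + z f'' / f' = (1 + 1 / (1 - z)) / 2 have positive real part, while
   (z / f)^2 f' = (1 + u)^2 / (4 u) is unbounded near z = 1.

   Holomorphy is only complex differentiability, so regularity of f' has to be
   derived.  Path integrals are avoided: Goursat's subdivision argument is run on
   dyadic left Riemann sums, which are exactly additive under subdivision and
   vanish exactly on affine functions; through the exponential it yields the mean
   value property, from which Cauchy's estimate, the differentiability of f' and
   the maximum principle follow. *)
Require Import Defs.
From mathcomp Require Import all_boot all_order all_algebra.
From mathcomp Require Import all_classical all_reals all_analysis.
From mathcomp Require Import complex.
From mathcomp Require Import ring lra.
Import Order.TTheory GRing.Theory Num.Theory ComplexField.
Import numFieldNormedType.Exports.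
Import Normc.
Set Implicit Arguments.
Unset Strict Implicit.
Unset Printing Implicit Defensive.
Local Open Scope ring_scope.

(** * Real-valued modulus, real part and imaginary part *)

Section Modulus.
Variable R : realType.
Implicit Types (z w : R[i]) (x y : R).

Lemma normc_ge0 z : 0 <= normc z.
Proof. by case: z => a b; exact: sqrtr_ge0. Qed.

Lemma normc_eq0 z : (normc z == 0) = (z == 0).
Proof.
by apply/eqP/eqP => [/eq0_normc //|->]; exact: normc0.
Qed.

Lemma normc_gt0 z : (0 < normc z) = (z != 0).
Proof. by rewrite lt_def normc_ge0 andbT normc_eq0. Qed.

Lemma normcB z w : normc (z - w) <= normc z + normc w.
Proof. by rewrite (le_trans (le_normcD _ _))// normcN. Qed.

Lemma normcBC z w : normc (z - w) = normc (w - z).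
Proof. by rewrite -normcN opprB. Qed.

Lemma normc_triangle u z w : normc (z - w) <= normc (z - u) + normc (u - w).
Proof. by rewrite (_ : z - w = (z - u) + (u - w)) ?le_normcD//; ring. Qed.

Lemma normc_lerB z w : normc z - normc w <= normc (z - w).
Proof. by have := le_normcD (z - w) w; rewrite subrK; lra. Qed.

Lemma normc_real x : normc (x%:C)%C = `|x|.
Proof. by rewrite /normc /= expr0n /= addr0 sqrtr_sqr. Qed.

Lemma sqr_normc_ReIm z : normc z ^+ 2 = complex.Re z ^+ 2 + complex.Im z ^+ 2.
Proof. by case: z => a b; rewrite sqr_sqrtr ?addr_ge0 ?sqr_ge0. Qed.

Lemma ReD z w : complex.Re (z + w) = complex.Re z + complex.Re w.
Proof. by case: z; case: w. Qed.

Lemma ReN z : complex.Re (- z) = - complex.Re z.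
Proof. by case: z. Qed.

Lemma ReM z w : complex.Re (z * w) =
  complex.Re z * complex.Re w - complex.Im z * complex.Im w.
Proof. by case: z; case: w. Qed.

Lemma ImD z w : complex.Im (z + w) = complex.Im z + complex.Im w.
Proof. by case: z; case: w. Qed.

Lemma ImN z : complex.Im (- z) = - complex.Im z.
Proof. by case: z. Qed.

Lemma ImM z w : complex.Im (z * w) =
  complex.Re z * complex.Im w + complex.Im z * complex.Re w.
Proof. by case: z => a b; case: w. Qed.

Lemma Re_le_normc z : `|complex.Re z| <= normc z.
Proof.
rewrite -(ler_pXn2r (ltn0Sn 1)) ?nnegrE ?normr_ge0 ?normc_ge0//.
by rewrite sqr_normc_ReIm real_normK ?num_real// lerDl sqr_ge0.
Qed.

Lemma Im_le_normc z : `|complex.Im z| <= normc z.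
Proof.
rewrite -(ler_pXn2r (ltn0Sn 1)) ?nnegrE ?normr_ge0 ?normc_ge0//.
by rewrite sqr_normc_ReIm real_normK ?num_real// lerDr sqr_ge0.
Qed.

Lemma normc_le_ReIm z : normc z <= `|complex.Re z| + `|complex.Im z|.
Proof.
rewrite {1}[z]complexE (le_trans (le_normcD _ _))// normcM !normc_real.
by rewrite /normc /= expr0n expr1n add0r sqrtr1 mul1r.
Qed.

(** Multiplication by [c] turns a modulus into a real part, which reduces bounds on moduli to bounds
    on real parts. *)
Lemma unimodular_rotation w : exists2 c, normc c = 1 & c * w = ((normc w)%:C)%C.
Proof.
have [->|w0] := eqVneq w 0; first by exists 1; rewrite ?normc1// mulr0 normc0.
exists (((normc w)%:C)%C / w); last by rewrite divfK.
by rewrite normcM normcV normc_real ger0_norm ?normc_ge0// divff// normc_eq0.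
Qed.

End Modulus.

(** * Compactness of rectangles by repeated halving *)

Section Bisection.
Variable R : realType.

Lemma exp2_small (a t : R) : 0 < t -> exists k, a / 2 ^+ k < t.
Proof.
move=> t0; have [k ak] : exists k : nat, `|a| / t < k%:R.
  by exists (Num.bound (`|a| / t)); apply: archi_boundP; rewrite divr_ge0// ltW.
exists k; rewrite ltr_pdivrMr ?exprn_gt0// (le_lt_trans (ler_norm a))//.
move: ak; rewrite ltr_pdivrMr// => /lt_le_trans; apply.
rewrite mulrC ler_wpM2l ?(ltW t0)// -natrX ler_nat ltnW//.
exact: ltn_expl.
Qed.

(** Left ends increase and right ends decrease, so the supremum of the left ends lies in every
    interval. *)
Lemma nested_intervals (a : R) (u : nat -> R) : 0 <= a ->
  (forall k, u k <= u k.+1 <= u k + a / 2 ^+ k.+1) ->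
  exists X, forall k, u k <= X <= u k + a / 2 ^+ k.
Proof.
move=> a0 hu.
have mono : {homo u : m n / (m <= n)%N >-> m <= n}.
  by apply: homo_leq => // [? ? ?|k]; [exact: le_trans|case/andP: (hu k)].
have dec : {homo (fun k => - (u k + a / 2 ^+ k)) : m n / (m <= n)%N >-> m <= n}.
  apply: homo_leq => // [? ? ?|k]; first exact: le_trans.
  have /andP[_] := hu k.
  suff : a / 2 ^+ k = a / 2 ^+ k.+1 + a / 2 ^+ k.+1 by lra.
  by rewrite exprS; field; rewrite expf_neq0.
have ub m k : u m <= u k + a / 2 ^+ k.
  have := mono _ _ (leq_maxl m k); have := dec _ _ (leq_maxr m k).
  have : 0 <= a / 2 ^+ maxn m k by rewrite divr_ge0 ?exprn_ge0.
  lra.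
have hs : has_sup (range u).
  by split; [exists (u 0%N), 0%N|exists (u 0%N + a / 2 ^+ 0) => _ [m _ <-]].
exists (sup (range u)) => k; apply/andP; split.
  by apply: sup_upper_bound => //; exists k.
by apply: ge_sup => [|_ [m _ <-]//]; case: hs.
Qed.

(** Otherwise a failing quarter can be chosen at every stage, and these quarters shrink to a point
    that violates the local hypothesis. This stands in for compactness of the rectangle; [k] records
    the side lengths [a / 2 ^+ k] and [b / 2 ^+ k]. *)
Lemma bisection (a b : R) (P : R -> R -> nat -> Prop) (x y : R) :
  0 <= a -> 0 <= b ->
  (forall x y k, (forall i j : bool,
      P (x + i%:R * (a / 2 ^+ k.+1)) (y + j%:R * (b / 2 ^+ k.+1)) k.+1) ->
    P x y k) ->
  (forall X Y, x <= X <= x + a -> y <= Y <= y + b -> exists2 t, 0 < t &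
    forall k x y, x <= X <= x + a / 2 ^+ k -> y <= Y <= y + b / 2 ^+ k ->
      (a + b) / 2 ^+ k < t -> P x y k) ->
  P x y 0%N.
Proof.
move=> a0 b0 split local; apply: contrapT => nP.
pose child k (p : R * R) (ij : bool * bool) :=
  (p.1 + ij.1%:R * (a / 2 ^+ k.+1), p.2 + ij.2%:R * (b / 2 ^+ k.+1)).
(* A quarter is chosen, arbitrarily, even where [P] holds, so that the recursion [s] is total. *)
have hc k p : exists ij, ~ P p.1 p.2 k ->
    ~ P (child k p ij).1 (child k p ij).2 k.+1.
  apply: contrapT => H; apply: H.
  have [Pp|nPp] := pselect (P p.1 p.2 k); first by exists (true, true).
  apply: contrapT => H; apply: nPp; apply: split => i j.
  by apply: contrapT => nPij; apply: H; exists (i, j).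
pose s := fix s k := if k is k'.+1 then child k' (s k') (projT1 (cid (hc k' (s k'))))
                     else (x, y).
have sP k : ~ P (s k).1 (s k).2 k.
  by elim: k => [//|k IH]; rewrite /=; case: cid => ij /= /(_ IH).
have step (c : R) (i : bool) k v : 0 <= c ->
    v <= v + i%:R * (c / 2 ^+ k.+1) <= v + c / 2 ^+ k.+1.
  move=> c0; have : 0 <= c / 2 ^+ k.+1 by rewrite divr_ge0 ?exprn_ge0.
  by case: i => /=; lra.
have [X hX] : exists X, forall k, (s k).1 <= X <= (s k).1 + a / 2 ^+ k.
  by apply: nested_intervals => // k; apply: step.
have [Y hY] : exists Y, forall k, (s k).2 <= Y <= (s k).2 + b / 2 ^+ k.
  by apply: nested_intervals => // k; apply: step.
have [||t t0 ht] := local X Y.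
- by have := hX 0%N; rewrite expr0 divr1.
- by have := hY 0%N; rewrite expr0 divr1.
have [k hk] := exp2_small (a + b) t0.
exact: (sP k) (ht _ _ _ (hX k) (hY k) hk).
Qed.

End Bisection.

(** * Goursat's theorem for dyadic Riemann sums *)

Section Goursat.
Variable R : realType.
Local Notation C := R[i].
Implicit Types (H : C -> C) (w h v : C).

(** The expansion is free of division and uses the real-valued modulus: errors are estimated in [R],
    and [w = z] is not a special case. *)
Definition cderiv (f : C -> C) (z d : C) : Prop :=
  forall e : R, 0 < e -> exists2 t : R, 0 < t &
    forall w, normc (w - z) < t ->
      normc (f w - f z - d * (w - z)) <= e * normc (w - z).

(* The average of [H] over the [2 ^ n] left endpoints of the equal subdivision
   of the segment [w, w + v]. *)
Fixpoint dyadic_mean H n w v : C :=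
  if n is m.+1 then
    (dyadic_mean H m w (v / 2) + dyadic_mean H m (w + v / 2) (v / 2)) / 2
  else H w.

(* The left Riemann sum of the integral of [H] along the boundary of the
   parallelogram spanned by [h] and [v] at the corner [w]. *)
Definition boundary_sum H n w h v : C :=
  h * (dyadic_mean H n w h - dyadic_mean H n (w + v) h) +
  v * (dyadic_mean H n (w + h) v - dyadic_mean H n w v).

Lemma dyadic_meanD H1 H2 n w v : dyadic_mean (fun z => H1 z + H2 z) n w v =
  dyadic_mean H1 n w v + dyadic_mean H2 n w v.
Proof. by elim: n w v => //= n IH w v; rewrite !IH; field. Qed.

(** Translation by [u] adds [d * u] to every sample. In a boundary sum the two pairs of opposite
    sides thus give [- h * d * v] and [v * d * h], which cancel at every level [n]. *)
Lemma dyadic_mean_affine c d n w u v :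
  dyadic_mean (fun z => c + d * z) n (w + u) v =
  dyadic_mean (fun z => c + d * z) n w v + d * u.
Proof.
elim: n w v => [|n IH] w v /=; first by ring.
by rewrite addrAC !IH; field.
Qed.

(** A dyadic mean is an iterated midpoint of samples. With balls for [P] this gives error bounds,
    with half-planes bounds on real parts. *)
Lemma dyadic_mean_convex (P : C -> Prop) H n w v :
  (forall z1 z2, P z1 -> P z2 -> P ((z1 + z2) / 2)) ->
  (forall t : R, 0 <= t <= 1 -> P (H (w + (t%:C)%C * v))) ->
  P (dyadic_mean H n w v).
Proof.
move=> Pc; elim: n w v => [|n IH] w v Pt /=.
  by have := Pt 0; rewrite mul0r addr0; apply; rewrite lexx ler01.
apply: Pc; apply: IH => t t01.
- have -> : (t%:C)%C * (v / 2) = ((t / 2)%:C)%C * v.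
    by rewrite rmorphM/= fmorphV/= rmorph_nat; field.
  by apply: Pt; lra.
- have -> : w + v / 2 + (t%:C)%C * (v / 2) = w + (((1 + t) / 2)%:C)%C * v.
    by rewrite rmorphM/= fmorphV/= rmorph_nat rmorphD/= rmorph1; field.
  by apply: Pt; lra.
Qed.

Lemma dyadic_mean_periodic H n w u v : (forall z, H (z + u) = H z) ->
  dyadic_mean H n (w + u) v = dyadic_mean H n w v.
Proof. by move=> Hu; elim: n w v => //= n IH w v; rewrite addrAC !IH. Qed.

Lemma normc_half (z : C) : normc (z / 2) = normc z / 2.
Proof.
rewrite normcM normcV (_ : 2 = (2%:R : R)%:C%C); last by rewrite rmorph_nat.
by rewrite normc_real ger0_norm.
Qed.

Lemma ball_midpoint c (B : R) z1 z2 : normc (z1 - c) <= B -> normc (z2 - c) <= B ->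
  normc ((z1 + z2) / 2 - c) <= B.
Proof.
move=> h1 h2; rewrite (_ : _ - c = ((z1 - c) + (z2 - c)) / 2); last by field.
by rewrite normc_half; have := le_normcD (z1 - c) (z2 - c); lra.
Qed.

(** Each inner edge occurs in two quarters with opposite signs and the same sample points, so it
    cancels without error. The level drops by one because the sides are halved. *)
Lemma boundary_sum_split H n w h v : boundary_sum H n.+1 w h v =
  boundary_sum H n w (h / 2) (v / 2) +
  boundary_sum H n (w + h / 2) (h / 2) (v / 2) +
  boundary_sum H n (w + v / 2) (h / 2) (v / 2) +
  boundary_sum H n (w + h / 2 + v / 2) (h / 2) (v / 2).
Proof.
rewrite /boundary_sum /=.
rewrite (_ : w + h / 2 + v / 2 + v / 2 = w + v + h / 2); last by field.
rewrite (_ : w + h / 2 + v / 2 + h / 2 = w + h + v / 2); last by field.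
rewrite (_ : w + v / 2 + v / 2 = w + v); last by field.
rewrite (_ : w + h / 2 + h / 2 = w + h); last by field.
rewrite (_ : w + v / 2 + h / 2 = w + h / 2 + v / 2); last by field.
by field.
Qed.

Lemma boundary_sum_affine c d n w h v :
  boundary_sum (fun z => c + d * z) n w h v = 0.
Proof. by rewrite /boundary_sum !dyadic_mean_affine; ring. Qed.

Lemma boundary_sumD H1 H2 n w h v : boundary_sum (fun z => H1 z + H2 z) n w h v =
  boundary_sum H1 n w h v + boundary_sum H2 n w h v.
Proof. by rewrite /boundary_sum !dyadic_meanD; ring. Qed.

(** Subtracting the first-order expansion at [W] changes nothing, affine functions having zero
    boundary sum. The remainder is at most [e * (a + b)] on a rectangle of perimeter
    [2 * (a + b)]. *)
Lemma goursat_local H (W d : C) (e t a b : R) n w :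
  0 <= a -> 0 <= b ->
  (forall z, normc (z - W) < t ->
    normc (H z - H W - d * (z - W)) <= e * normc (z - W)) ->
  0 <= e ->
  complex.Re w <= complex.Re W <= complex.Re w + a ->
  complex.Im w <= complex.Im W <= complex.Im w + b ->
  a + b < t ->
  normc (boundary_sum H n w (Complex a 0) (Complex 0 b)) <= 2 * e * (a + b) ^+ 2.
Proof.
move=> a0 b0 Hd e0 hRe hIm abt.
pose r z := H z - H W - d * (z - W).
have -> : H = (fun z => (H W - d * W + d * z) + r z).
  by apply/funext => z; rewrite /r; ring.
rewrite boundary_sumD boundary_sum_affine add0r.
have rB z : complex.Re w <= complex.Re z <= complex.Re w + a ->
    complex.Im w <= complex.Im z <= complex.Im w + b -> normc (r z) <= e * (a + b).
  move=> zRe zIm; have zW : normc (z - W) <= a + b.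
    rewrite (le_trans (normc_le_ReIm _))// lerD//.
      by rewrite ReD ReN ler_norml; lra.
    by rewrite ImD ImN ler_norml; lra.
  by rewrite (le_trans (Hd _ _)) ?(le_lt_trans zW)// ler_wpM2l.
have mB u v : (forall t : R, 0 <= t <= 1 -> normc (r (u + (t%:C)%C * v)) <= e * (a + b)) ->
    normc (dyadic_mean r n u v) <= e * (a + b).
  move=> uv; rewrite -[dyadic_mean _ _ _ _]subr0.
  apply: (dyadic_mean_convex (P := fun z => normc (z - 0) <= e * (a + b))).
    by move=> z1 z2; exact: ball_midpoint.
  by move=> s s01; rewrite subr0; exact: uv.
have sB (s c : R) : 0 <= s <= 1 -> 0 <= c -> 0 <= s * c <= c.
  by move=> s01 c0; nra.
rewrite /boundary_sum (le_trans (le_normcD _ _))// !normcM.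
have -> : normc (Complex a 0) = a by rewrite normc_real ger0_norm.
have -> : normc (Complex 0 b) = b.
  by rewrite /normc expr0n add0r sqrtr_sqr ger0_norm.
have D4 u1 u2 : normc u1 <= e * (a + b) -> normc u2 <= e * (a + b) ->
    normc (u1 - u2) <= 2 * e * (a + b).
  by move=> h1 h2; have := normcB u1 u2; lra.
have -> : 2 * e * (a + b) ^+ 2 = a * (2 * e * (a + b)) + b * (2 * e * (a + b)).
  by ring.
by apply: lerD; apply: ler_wpM2l => //; apply: D4; apply: mB => s s01;
  have sa := sB s a s01 a0; have sb := sB s b s01 b0; apply: rB;
  rewrite !(ReD, ImD, ReM, ImM) /=; lra.
Qed.

(** The local bound is quadratic in the side lengths, hence divided by four at each halving, so the
    bounds of the four quarters add up to that of the whole. *)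
Theorem goursat H (x y a b : R) : 0 <= a -> 0 <= b ->
  (forall X Y, x <= X <= x + a -> y <= Y <= y + b ->
    exists d, cderiv H (Complex X Y) d) ->
  forall e : R, 0 < e -> exists N, forall n, (N <= n)%N ->
    normc (boundary_sum H n (Complex x y) (Complex a 0) (Complex 0 b)) <= e.
Proof.
move=> a0 b0 Hd e e0.
(* Makes [2 * e' * (a + b) ^+ 2] at most [e]; the added 1 keeps the denominator positive when
   [a + b = 0]. *)
pose e' := e / (2 * (a + b) ^+ 2 + 1).
have den : 0 < 2 * (a + b) ^+ 2 + 1 by have := sqr_ge0 (a + b); lra.
have e'0 : 0 < e' by rewrite divr_gt0.
suff [N HN] : exists N, forall n, (N <= n)%N ->
    normc (boundary_sum H n (Complex x y) (Complex (a / 2 ^+ 0) 0)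
      (Complex 0 (b / 2 ^+ 0))) <= 2 * e' * ((a + b) / 2 ^+ 0) ^+ 2.
  exists N => n /HN; rewrite expr0 !divr1 => /le_trans; apply.
  rewrite /e' mulrAC mulrA ler_pdivrMr//; nra.
apply: (bisection (P := fun x y k => exists N, forall n, (N <= n)%N ->
    normc (boundary_sum H n (Complex x y) (Complex (a / 2 ^+ k) 0)
      (Complex 0 (b / 2 ^+ k))) <= 2 * e' * ((a + b) / 2 ^+ k) ^+ 2) a0 b0).
- move=> {Hd}x {}y k Hk.
  have [N1 H1] := Hk false false; have [N2 H2] := Hk true false.
  have [N3 H3] := Hk false true; have [N4 H4] := Hk true true.
  (* The split consumes one level, hence the successor. *)
  exists (maxn (maxn N1 N2) (maxn N3 N4)).+1; case=> // n.
  rewrite ltnS !geq_max => /andP[/andP[n1 n2] /andP[n3 n4]].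
  move: {H1 H2 H3 H4}(H1 _ n1) (H2 _ n2) (H3 _ n3) (H4 _ n4).
  rewrite !mul0r !addr0 !mul1r boundary_sum_split.
  have E (c : R) : c / 2 ^+ k.+1 = c / 2 ^+ k / 2.
    by rewrite exprS; field; rewrite expf_neq0.
  have half (p q : R) : Complex p q / 2 = Complex (p / 2) (q / 2).
    apply: (canLR (mulfK _)); rewrite ?pnatr_eq0// mulr_natr mulr2n.
    by congr Complex; field.
  rewrite !half !E mul0r.
  rewrite !(_ : forall p q r s : R, Complex p q + Complex r s = Complex (p + r) (q + s))//.
  rewrite !addr0.
  move: (boundary_sum _ _ _ _ _) => s1; move: (boundary_sum _ _ _ _ _) => s2.
  move: (boundary_sum _ _ _ _ _) => s3; move: (boundary_sum _ _ _ _ _) => s4.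
  have := le_normcD (s1 + s2 + s3) s4; have := le_normcD (s1 + s2) s3.
  have := le_normcD s1 s2; set L := (a + b) / 2 ^+ k.
  by rewrite (_ : (L / 2) ^+ 2 = L ^+ 2 / 4); [lra|field].
- move=> X Y hX hY; have [d /(_ _ e'0) [t t0 ht]] := Hd X Y hX hY.
  exists t => // k x' y' xX yY abt; exists 0%N => n _.
  rewrite [(a + b) / _]mulrDl; apply: (goursat_local (W := Complex X Y) (d := d) (t := t)) => //.
  + by rewrite divr_ge0 ?exprn_ge0.
  + by rewrite divr_ge0 ?exprn_ge0.
  + exact: ltW.
  + by rewrite -mulrDl.
Qed.

End Goursat.

(** * Derivatives in epsilon-delta form over a numeric field *)

Section DerivativeEpsilonDelta.

(** Multiplying the difference quotient by its increment removes the division. The field is left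
    general because both the real functions [expR], [cos], [sin] and the complex derivative need
    this form. *)
Lemma is_derive1_epsP (K : numFieldType) (f : K^o -> K^o) (x d : K^o) :
  is_derive x 1 f d <-> forall e : K, 0 < e -> exists2 t : K, 0 < t &
    forall w, `|w - x| < t -> `|f w - f x - d * (w - x)| <= e * `|w - x|.
Proof.
pose q (h : K) : K := h^-1 *: ((f \o shift x) (h *: 1) - f x).
have qE h : h != 0 -> `|d - q h| = `|f (h + x) - f x - d * h| / `|h|.
  move=> h0; rewrite -normfV -normrM distrC /q /= [_ *: 1]mulr1.
  by congr `|_|; rewrite /GRing.scale/=; field.
have -> : is_derive x 1 f d <-> (q h @[h --> 0^'] --> (d : K^o))%classic.
  split; first by case=> + <-.
  by move=> qd; apply: DeriveDef; [exact: cvgP qd|exact: cvg_lim qd].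
split.
- move=> /cvgrPdist_le qd e e0; have := qd e e0.
  rewrite /prop_near1 /dnbhs /= => /nbhs_ballP[t t0 ht]; exists t => // w wt.
  have [->|wx] := eqVneq w x; first by rewrite !subrr mulr0 subr0 normr0 mulr0.
  have wx0 : w - x != 0 by rewrite subr_eq0.
  have := ht (w - x); rewrite /ball/= sub0r normrN => /(_ wt wx0).
  by rewrite qE// subrK ler_pdivrMr// normr_gt0.
- move=> H; apply/cvgrPdist_le => e e0; have [t t0 ht] := H e e0.
  apply/nbhs_ballP; exists t => //= h; rewrite /ball/= sub0r normrN => hb h0.
  rewrite qE// ler_pdivrMr ?normr_gt0//.
  by have := ht (h + x); rewrite addrK => /(_ hb).
Qed.

End DerivativeEpsilonDelta.

(** * Calculus of complex derivatives and the mean value inequality *)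

Section ComplexDerivative.
Variable R : realType.
Local Notation C := R[i].
Implicit Types (f g : C -> C) (z w d : C).

Lemma normc_lt z (t : R) : (`|z| < (t%:C)%C) = (normc z < t).
Proof. by rewrite -ltcR. Qed.

Lemma gt0_realC z : 0 < z -> exists2 t : R, 0 < t & z = (t%:C)%C.
Proof.
case: z => a b; rewrite ltcE /= => /andP[/eqP -> a0]; by exists a.
Qed.

(** In the partial order of [R[i]] a positive element is a positive real, so both sides quantify
    over the same [e] and [t]. *)
Lemma cderivP f z d :
  cderiv f z d <-> is_derive (z : Cplx R) 1 (f : Cplx R -> Cplx R) d.
Proof.
rewrite is_derive1_epsP; split=> H e.
- move=> /gt0_realC [e' e0 ->]; have [t t0 ht] := H e' e0.
  exists (t%:C)%C => [|w]; first by rewrite ltcR.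
  rewrite normc_lt => /ht; rewrite -lecR rmorphM; exact.
- move=> e0; have [|t /gt0_realC [t' t0 ->] ht] := H (e%:C)%C; first by rewrite ltcR.
  exists t' => // w; rewrite -normc_lt => /ht.
  by rewrite -[`|_ - z|]/((normc _)%:C)%C -rmorphM -lecR.
Qed.

Lemma cderiv_unique f z d1 d2 : cderiv f z d1 -> cderiv f z d2 -> d1 = d2.
Proof. by move=> /cderivP[_ <-] /cderivP[_ <-]. Qed.

Lemma cderiv_eq f z d1 d2 : cderiv f z d1 -> d1 = d2 -> cderiv f z d2.
Proof. by move=> + <-. Qed.

Lemma cderiv_near f g z d (t : R) : 0 < t ->
  (forall w, normc (w - z) < t -> f w = g w) -> cderiv f z d -> cderiv g z d.
Proof.
move=> t0 fg fd e /fd[t1 t10 ht1]; exists (Num.min t t1) => [|w].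
  by rewrite lt_min t0.
rewrite lt_min => /andP[w1 w2]; rewrite -!fg//; first exact: ht1.
by rewrite subrr normc0.
Qed.

Lemma cderiv_cst c z : cderiv (fun=> c) z 0.
Proof. by apply/cderivP; exact: is_derive_cst. Qed.

Lemma cderiv_id z : cderiv id z 1.
Proof. by apply/cderivP; exact: is_derive_id. Qed.

Lemma cderivD f g z d1 d2 : cderiv f z d1 -> cderiv g z d2 ->
  cderiv (fun w => f w + g w) z (d1 + d2).
Proof. by move=> /cderivP h1 /cderivP h2; apply/cderivP; exact: is_deriveD. Qed.

Lemma cderivB f g z d1 d2 : cderiv f z d1 -> cderiv g z d2 ->
  cderiv (fun w => f w - g w) z (d1 - d2).
Proof. by move=> /cderivP h1 /cderivP h2; apply/cderivP; exact: is_deriveB. Qed.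

Lemma cderivM f g z d1 d2 : cderiv f z d1 -> cderiv g z d2 ->
  cderiv (fun w => f w * g w) z (d1 * g z + f z * d2).
Proof.
move=> /cderivP h1 /cderivP h2; apply/cderivP.
apply: (is_derive_eq (is_deriveM h1 h2)).
by rewrite /GRing.scale/= addrC mulrC.
Qed.

Lemma cderivV f z d : f z != 0 -> cderiv f z d ->
  cderiv (fun w => (f w)^-1) z (- d / f z ^+ 2).
Proof.
move=> f0 /cderivP h; apply/cderivP; split.
  by apply: derivableV => //; case: h.
by rewrite deriveV//; case: h => _ ->; rewrite /GRing.scale/= mulrC mulrN mulNr.
Qed.

Lemma cderiv_div f g z d1 d2 : g z != 0 -> cderiv f z d1 -> cderiv g z d2 ->
  cderiv (fun w => f w / g w) z ((d1 * g z - f z * d2) / g z ^+ 2).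
Proof.
move=> g0 h1 h2; apply: cderiv_eq (cderivM h1 (cderivV g0 h2)) _.
by field.
Qed.

Lemma cderiv_lip f z d : cderiv f z d -> exists2 t : R, 0 < t &
  forall w, normc (w - z) < t -> normc (f w - f z) <= (normc d + 1) * normc (w - z).
Proof.
move=> /(_ 1 ltr01) [t t0 ht]; exists t => // w /ht.
have := le_normcD (f w - f z - d * (w - z)) (d * (w - z)).
by rewrite subrK normcM; lra.
Qed.

Definition ccont f z : Prop := forall e : R, 0 < e -> exists2 t : R, 0 < t &
  forall w, normc (w - z) < t -> normc (f w - f z) < e.

Lemma cderiv_cont f z d : cderiv f z d -> ccont f z.
Proof.
move=> /cderiv_lip[t t0 ht] e e0; have dp : 0 < normc d + 1.
  by have := normc_ge0 d; lra.
exists (Num.min t (e / (normc d + 1))) => [|w]; first by rewrite lt_min t0 divr_gt0.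
rewrite lt_min => /andP[/ht h1]; rewrite ltr_pdivlMr// => h2.
by rewrite (le_lt_trans h1)// mulrC.
Qed.

Lemma ccontM_l c f z : ccont f z -> ccont (fun w => c * f w) z.
Proof.
move=> fc e e0; have cp : 0 < normc c + 1 by have := normc_ge0 c; lra.
have [|t t0 ht] := fc (e / (normc c + 1)); first by rewrite divr_gt0.
exists t => // w /ht; rewrite ltr_pdivlMr// -mulrBr normcM => h.
by have := normc_ge0 (f w - f z); nra.
Qed.

Lemma cderiv_comp f g z d1 d2 : cderiv g z d1 -> cderiv f (g z) d2 ->
  cderiv (fun w => f (g w)) z (d2 * d1).
Proof.
move=> gd fd e e0.
have K0 : 0 < normc d1 + 1 by have := normc_ge0 d1; lra.
have L0 : 0 < normc d2 + 1 by have := normc_ge0 d2; lra.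
(* Half of the error [e] is allotted to each expansion; the added 1 in [normc d1 + 1] and
   [normc d2 + 1] keeps the denominators positive. *)
have [|t1 t10 h1] := fd (e / (2 * (normc d1 + 1))); first by rewrite divr_gt0// mulr_gt0.
have [|t2 t20 h2] := gd (e / (2 * (normc d2 + 1))); first by rewrite divr_gt0// mulr_gt0.
have [t3 t30 h3] := cderiv_lip gd.
have [t4 t40 h4] := cderiv_cont gd t10.
exists (Num.min (Num.min t2 t3) t4) => [|w]; first by rewrite !lt_min t20 t30.
rewrite !lt_min => /andP[/andP[w2 w3] w4].
have {}h1 := h1 _ (h4 _ w4); have {}h2 := h2 _ w2; have {}h3 := h3 _ w3.
set gw := g w - g z in h1 h2 h3; set u := w - z in h2 h3 *.
have -> : f (g w) - f (g z) - d2 * d1 * u =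
  (f (g w) - f (g z) - d2 * gw) + d2 * (gw - d1 * u) by ring.
rewrite (le_trans (le_normcD _ _))// normcM.
have E1 : e / (2 * (normc d1 + 1)) * normc gw <= e / 2 * normc u.
  have -> : e / 2 * normc u = e / (2 * (normc d1 + 1)) * ((normc d1 + 1) * normc u).
    by field; rewrite gt_eqF.
  by rewrite ler_wpM2l// divr_ge0 ?mulr_ge0 ?(ltW e0) ?(ltW K0).
have E2 : normc d2 * normc (gw - d1 * u) <= e / 2 * normc u.
  have -> : e / 2 * normc u = (normc d2 + 1) * (e / (2 * (normc d2 + 1)) * normc u).
    by field; rewrite gt_eqF.
  by rewrite ler_pM ?normc_ge0//; lra.
lra.
Qed.

Lemma cderiv_shift f z c d : cderiv f (z + c) d -> cderiv (fun w => f (w + c)) z d.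
Proof.
move=> fd; apply: cderiv_eq (cderiv_comp (cderivD (cderiv_id z) (cderiv_cst c z)) fd) _.
by rewrite addr0 mulr1.
Qed.

(** Rolle's theorem fails for complex values. Instead, the bound with [M + e'] is additive when the
    parameter interval is halved and holds on short intervals by differentiability; [bisection] is
    used with a degenerate second side. *)
Lemma mean_value_inequality f z v (M : R) : 0 <= M ->
  (forall t : R, 0 <= t <= 1 -> exists2 d, cderiv f (z + (t%:C)%C * v) d & normc d <= M) ->
  normc (f (z + v) - f z) <= M * normc v.
Proof.
move=> M0 fd; apply/ler_addgt0Pr => e e0.
have v1 : 0 < normc v + 1 by have := normc_ge0 v; lra.
pose e' := e / (normc v + 1); have e'0 : 0 < e' by rewrite divr_gt0.
suff : normc (f (z + ((0 + 1 / 2 ^+ 0)%:C)%C * v) - f (z + ((0 : R)%:C)%C * v)) <=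
    (M + e') * (normc v / 2 ^+ 0).
  rewrite expr0 !divr1 add0r mul1r mul0r addr0 => /le_trans; apply.
  rewrite mulrDl lerD2l /e' mulrAC ler_pdivrMr//; have := normc_ge0 v; nra.
apply: (bisection (P := fun s _ k => normc (f (z + ((s + 1 / 2 ^+ k)%:C)%C * v) -
    f (z + (s%:C)%C * v)) <= (M + e') * (normc v / 2 ^+ k)) (b := 0) (y := 0) ler01 (lexx 0)).
- move=> s _ k H; have := H false false; have := H true true.
  rewrite !mul0r !addr0 !mul1r -addrA.
  have -> : 2 ^- k.+1 + 2 ^- k.+1 = 2 ^- k :> R.
    by rewrite exprS; field; rewrite expf_neq0.
  have -> : normc v / 2 ^+ k = normc v / 2 ^+ k.+1 + normc v / 2 ^+ k.+1.
    by rewrite exprS; field; rewrite expf_neq0.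
  set p := z + (s + 2 ^- k.+1)%:C%C * v => h1 h2.
  by have := normc_triangle (f p) (f (z + ((s + 2 ^- k)%:C)%C * v)) (f (z + (s%:C)%C * v)); lra.
- move=> X Y hX _; rewrite add0r in hX; have [d fX dM] := fd X hX.
  have [t t0 ht] := fX e' e'0.
  have near (p : R) : `|p - X| * normc v < t ->
      normc (f (z + (p%:C)%C * v) - f (z + (X%:C)%C * v)) <= (M + e') * (`|p - X| * normc v).
    move=> pX; have E : z + (p%:C)%C * v - (z + (X%:C)%C * v) = ((p - X)%:C)%C * v.
      by rewrite rmorphB/=; ring.
    have nE : normc (z + (p%:C)%C * v - (z + (X%:C)%C * v)) = `|p - X| * normc v.
      by rewrite E normcM normc_real.
    have := ht (z + (p%:C)%C * v); rewrite nE => /(_ pX).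
    set F := f _ - f _; set u := _ - _ in nE *.
    have := le_normcD (F - d * u) (d * u); rewrite subrK normcM nE.
    have : 0 <= `|p - X| * normc v by rewrite mulr_ge0// normc_ge0.
    nra.
  exists (t / (normc v + 1)) => [|k s y' sX _]; first by rewrite divr_gt0.
  rewrite addr0 ltr_pdivlMr// => kt.
  have k0 : 0 <= 1 / 2 ^+ k :> R by rewrite divr_ge0 ?exprn_ge0.
  have v0 := normc_ge0 v.
  have h1 := near s; have h2 := near (s + 1 / 2 ^+ k).
  (* As [X] lies between the two parameters, their distances to [X] add up exactly to the interval
     length. *)
  have E1 : `|s - X| = X - s by rewrite distrC ger0_norm; lra.
  have E2 : `|s + 1 / 2 ^+ k - X| = s + 1 / 2 ^+ k - X by rewrite ger0_norm; lra.
  rewrite E1 in h1; rewrite E2 in h2.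
  have {}h1 : _ := h1 ltac:(nra); have {}h2 := h2 ltac:(nra).
  have := normc_triangle (f (z + (X%:C)%C * v))
    (f (z + ((s + 1 / 2 ^+ k)%:C)%C * v)) (f (z + (s%:C)%C * v)).
  rewrite [normc (f (z + (X%:C)%C * v) - _)]normcBC.
  have -> : (M + e') * (normc v / 2 ^+ k) =
      (M + e') * ((s + 1 / 2 ^+ k - X) * normc v) + (M + e') * ((X - s) * normc v).
    by field; rewrite expf_neq0.
  lra.
Qed.

End ComplexDerivative.

(** * The complex exponential and its derivative *)

Section ComplexExponential.
Variable R : realType.
Local Notation C := R[i].
Implicit Types (z w : C).

Definition cexp z : C :=
  Complex (expR (complex.Re z) * cos (complex.Im z))
          (expR (complex.Re z) * sin (complex.Im z)).

Lemma cexpD z w : cexp (z + w) = cexp z * cexp w.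
Proof.
apply/eqP; rewrite eq_complex ReM ImM /= !ReD !ImD expRD cosD sinD.
by apply/andP; split; apply/eqP; ring.
Qed.

Lemma normc_cexp z : normc (cexp z) = expR (complex.Re z).
Proof.
by rewrite /normc /cexp !exprMn -mulrDr cos2Dsin2 mulr1 sqrtr_sqr ger0_norm.
Qed.

Lemma cexp_periodic z : cexp (z + Complex 0 (pi *+ 2)) = cexp z.
Proof. by rewrite /cexp ReD ImD /= addr0 cosD2pi sinD2pi. Qed.

Lemma cexp0 : cexp 0 = 1.
Proof. by rewrite /cexp /= cos0 sin0 expR0 mulr1 mulr0. Qed.

Lemma cderiv_cexp0 : cderiv cexp 0 1.
Proof.
have expand (g : R -> R) (d : R) : is_derive (0 : R) 1 g d -> forall e : R, 0 < e ->
    exists2 t : R, 0 < t & forall x, `|x| < t -> `|g x - g 0 - d * x| <= e * `|x|.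
  move=> /is_derive1_epsP gd e /gd [t t0 ht]; exists t => // x xt.
  by have := ht x; rewrite subr0 => /(_ xt).
(* The three error terms below cost [e'], [4 * e'] and [e'] times [normc w], six in all; [e' <= 1]
   serves to bound [1 + x] by 2. *)
move=> e e0; pose e' := Num.min 1 (e / 6).
have e'0 : 0 < e' by rewrite lt_min ltr01 divr_gt0.
have e'e : e' <= e / 6 by rewrite ge_min lexx orbT.
have [t1 t10 h1] := expand _ _ (is_derive_expR 0) e' e'0.
have [t2 t20 h2] := expand _ _ (is_derive_cos 0) e' e'0.
have [t3 t30 h3] := expand _ _ (is_derive_sin 0) e' e'0.
exists (Num.min (Num.min t1 t2) (Num.min t3 e')) => [|w].
  by rewrite !lt_min t10 t20 t30 ?ltr01 ?divr_gt0 ?e'0.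
rewrite subr0 cexp0 !lt_min => /andP[/andP[w1 w2] /andP[w3 w4]].
have {}w4 : normc w < e' by rewrite lt_min.
have xw := Re_le_normc w; have yw := Im_le_normc w.
set x := complex.Re w in xw *; set y := complex.Im w in yw *.
have {h1 w1} := h1 x (le_lt_trans xw w1).
have {h2 w2} := h2 y (le_lt_trans yw w2).
have {h3 w3} := h3 y (le_lt_trans yw w3).
rewrite expR0 cos0 sin0 !subr0 oppr0 mul0r !mul1r !subr0 => sy cy ex.
set A := sin y - y in sy; set B := cos y - 1 in cy; set D := expR x - 1 - x in ex.
(* Here [expR x = 1 + x + D] and [cos y + i sin y = (1 + i y) + (B + i A)], while
   [(1 + x) * (1 + i y)] exceeds [1 + w] by [i x y]. *)
have -> : cexp w - 1 - w =
    (D%:C)%C * Complex (cos y) (sin y) + (1 + x)%:C%C * Complex B A + Complex 0 (x * y).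
  apply/eqP; rewrite eq_complex !(ReD, ReN, ReM, ImD, ImN, ImM) /= -/x -/y /D /A /B.
  by apply/andP; split; apply/eqP; ring.
have ncis : normc (Complex (cos y) (sin y)) = 1.
  by rewrite /normc cos2Dsin2 sqrtr1.
have eyw : e' * `|y| <= e' * normc w by rewrite ler_wpM2l// ltW.
have exw : e' * `|x| <= e' * normc w by rewrite ler_wpM2l// ltW.
have nAB : normc (Complex B A) <= 2 * e' * normc w.
  by rewrite (le_trans (normc_le_ReIm _))//=; lra.
have nxy : normc (Complex 0 (x * y)) <= e' * normc w.
  rewrite /normc expr0n add0r sqrtr_sqr normrM ler_pM ?normr_ge0//.
  by rewrite (le_trans xw)// ltW.
have nx : `|1 + x| <= 2.
  have := ler_normD 1 x; rewrite normr1; have : e' <= 1 by rewrite ge_min lexx.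
  lra.
have n2 : normc ((1 + x)%:C%C * Complex B A) <= 4 * e' * normc w.
  rewrite normcM normc_real (_ : 4 * e' * normc w = 2 * (2 * e' * normc w)); last by ring.
  by rewrite ler_pM ?normc_ge0.
have n1 : normc ((D%:C)%C * Complex (cos y) (sin y)) <= e' * normc w.
  by rewrite normcM ncis mulr1 normc_real; lra.
rewrite (le_trans (le_normcD _ _))//.
have := le_normcD ((D%:C)%C * Complex (cos y) (sin y)) ((1 + x)%:C%C * Complex B A).
have : e' * normc w <= e / 6 * normc w by rewrite ler_wpM2r ?normc_ge0.
have := normc_ge0 w; nra.
Qed.

Lemma cderiv_cexp z : cderiv cexp z (cexp z).
Proof.
have := @cderiv_shift _ cexp z (- z) 1; rewrite subrr => /(_ cderiv_cexp0) h.
have := cderivM (cderiv_cst (cexp z) z) h.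
rewrite subrr mul0r add0r mulr1.
apply: (cderiv_near (t := 1)) => // w _.
by rewrite -cexpD addrC subrK.
Qed.

End ComplexExponential.

(** * The mean value property and Cauchy's estimate *)

Section MeanValueProperty.
Variable R : realType.
Local Notation C := R[i].
Implicit Types (f g : C -> C) (z w d : C).

(* In the coordinate [w |-> z0 + exp w] the annulus between a small circle and
   the given one becomes a rectangle whose horizontal sides cancel by
   periodicity, so that [goursat] compares the averages on both circles. *)
Lemma mean_halfplane g z0 (r0 r m : R) : 0 < r < r0 ->
  (forall z, 0 < normc (z - z0) < r0 -> exists d, cderiv g z d) ->
  ccont g z0 ->
  (forall z, normc (z - z0) = r -> complex.Re (g z) <= m) ->
  complex.Re (g z0) <= m.
Proof.
move=> /andP[r_gt0 rr0] gd gc gm; apply/ler_addgt0Pr => e e0.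
have e20 : 0 < e / 2 by rewrite divr_gt0.
have [t t0 ht] := gc _ e20.
(* The inner circle lies where [g] is within [e / 2] of [g z0], and strictly inside the circle of
   radius [r], so that the rectangle has positive width [a]. *)
pose r1 := Num.min (t / 2) (r / 2).
have r10 : 0 < r1 by rewrite lt_min !divr_gt0.
have r1t : r1 < t by have : r1 <= t / 2 by [rewrite ge_min lexx]; lra.
have r1r : r1 < r by have : r1 <= r / 2 by [rewrite ge_min lexx orbT]; lra.
pose a := ln r - ln r1; pose H (w : C) := g (z0 + cexp w).
have a0 : 0 < a by rewrite subr_gt0 ltr_ln ?posrE.
have p0 : 0 < (pi *+ 2 : R) by rewrite mulrn_wgt0// pi_gt0.
have circ w : normc (z0 + cexp w - z0) = expR (complex.Re w).
  by rewrite addrC addKr normc_cexp.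
have Hd X Y : ln r1 <= X <= ln r1 + a -> 0 <= Y <= 0 + pi *+ 2 ->
    exists d, cderiv H (Complex X Y) d.
  move=> /andP[X1 X2] _; have [|d hd] := gd (z0 + cexp (Complex X Y)).
    rewrite circ expR_gt0/= (le_lt_trans _ rr0)//.
    by rewrite -[leRHS](@lnK R)// ler_expR; move: X2; rewrite addrC subrK.
  exists (d * (0 + cexp (Complex X Y))).
  exact: cderiv_comp (cderivD (cderiv_cst _ _) (cderiv_cexp _)) hd.
(* The tolerance is the height of the rectangle times [e / 2]: only the vertical sides survive, and
   dividing by the height leaves the difference of the means [M2] over the outer and [M1] over the
   inner circle. *)
have [N /(_ _ (leqnn N))] := goursat (ltW a0) (ltW p0) Hd (mulr_gt0 p0 e20).
have Hper w : H (w + Complex 0 (pi *+ 2)) = H w by rewrite /H cexp_periodic.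
rewrite /boundary_sum dyadic_mean_periodic// subrr mulr0 add0r normcM.
have -> : normc (Complex 0 (pi *+ 2 : R)) = pi *+ 2.
  by rewrite /normc expr0n add0r sqrtr_sqr ger0_norm// ltW.
rewrite ler_pM2l//.
rewrite (_ : Complex (ln r1) 0 + Complex a 0 = Complex (ln r) 0); last first.
  by apply/eqP; rewrite eq_complex /= addr0 eqxx andbT addrC subrK.
set M2 := dyadic_mean _ _ _ _; set M1 := dyadic_mean _ _ _ _ => hM.
have hM2 : complex.Re M2 <= m.
  apply: (dyadic_mean_convex (P := fun z => complex.Re z <= m)).
    move=> z1 z2 h1 h2.
    have -> : (z1 + z2) / 2 = ((1 / 2 : R)%:C)%C * (z1 + z2).
      by rewrite rmorphM/= fmorphV/= rmorph1 rmorph_nat; field.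
    by rewrite ReM ReD /=; lra.
  move=> s _; apply: gm; rewrite circ ReD ReM /= mulr0 mul0r subrr addr0.
  by rewrite lnK// posrE.
have hM1 : normc (M1 - g z0) <= e / 2.
  apply: (dyadic_mean_convex (P := fun z => normc (z - g z0) <= e / 2)).
    by move=> z1 z2; exact: ball_midpoint.
  move=> s _; apply/ltW/ht; rewrite circ ReD ReM /= mulr0 mul0r subrr addr0.
  by rewrite lnK// posrE.
have := Re_le_normc (M2 - M1); have := Re_le_normc (M1 - g z0).
rewrite !ler_norml !ReD !ReN; lra.
Qed.

(** A rotation makes the value at [z0] real and nonnegative. Mere continuity at the centre suffices,
    which admits difference quotients. *)
Lemma mean_ball g z0 (r0 r B : R) : 0 < r < r0 ->
  (forall z, 0 < normc (z - z0) < r0 -> exists d, cderiv g z d) ->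
  ccont g z0 ->
  (forall z, normc (z - z0) = r -> normc (g z) <= B) ->
  normc (g z0) <= B.
Proof.
move=> rr0 gd gc gB; have [c c1 cg] := unimodular_rotation (g z0).
suff : complex.Re (c * g z0) <= B by rewrite cg.
apply: (mean_halfplane (g := fun w => c * g w) rr0).
- move=> z /gd[d hd]; exists (0 * g z + c * d).
  exact: cderivM (cderiv_cst c z) hd.
- exact: ccontM_l.
- move=> z /gB gzB; rewrite (le_trans (ler_norm _))// (le_trans (Re_le_normc _))//.
  by rewrite normcM c1 mul1r.
Qed.

Definition dquot f z0 d z := if z == z0 then d else (f z - f z0) / (z - z0).

Lemma dquot_cont f z0 d : cderiv f z0 d -> ccont (dquot f z0 d) z0.
Proof.
move=> fd e e0; have e20 : 0 < e / 2 by rewrite divr_gt0.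
have [t t0 ht] := fd _ e20; exists t => // w /ht; rewrite /dquot eqxx.
have [->|wz] := eqVneq w z0; first by rewrite !subrr normc0.
have wz0 : w - z0 != 0 by rewrite subr_eq0.
rewrite (_ : _ / _ - d = (f w - f z0 - d * (w - z0)) / (w - z0)); last by field.
by rewrite normcM normcV -ler_pdivrMr ?normc_gt0//; lra.
Qed.

Lemma cderiv_dquot f z0 d z d1 : z != z0 -> cderiv f z d1 ->
  cderiv (dquot f z0 d) z ((d1 * (z - z0) - (f z - f z0)) / (z - z0) ^+ 2).
Proof.
move=> zz0 fd; have z0' : z - z0 != 0 by rewrite subr_eq0.
have := cderiv_div (g := fun w => w - z0) (z := z) z0'
  (cderivB fd (cderiv_cst (f z0) z)) (cderivB (cderiv_id z) (cderiv_cst z0 z)).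
rewrite !subr0 mulr1; apply: (cderiv_near (t := normc (z - z0))).
  by rewrite normc_gt0.
move=> w; rewrite /dquot; case: eqVneq => // ->.
by rewrite normcBC ltxx.
Qed.

(** The derivative is the central value of the difference quotient, whose modulus on the circle is
    at most [B / r]. *)
Lemma cauchy_estimate f z0 d (r0 r B : R) : 0 < r < r0 ->
  (forall z, normc (z - z0) < r0 -> exists d, cderiv f z d) ->
  cderiv f z0 d ->
  (forall z, normc (z - z0) = r -> normc (f z - f z0) <= B) ->
  normc d <= B / r.
Proof.
move=> rr0 fd fd0 fB; have r_gt0 : 0 < r by case/andP: rr0.
have -> : d = dquot f z0 d z0 by rewrite /dquot eqxx.
apply: (mean_ball rr0).
- move=> z /andP[z0' /fd[d1 hd1]]; eexists; apply: cderiv_dquot hd1.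
  by move: z0'; rewrite normc_gt0 subr_eq0.
- exact: dquot_cont.
- move=> z zr; rewrite /dquot; case: eqVneq => [zz0|_].
    by move: r_gt0; rewrite -zr zz0 subrr normc0 ltxx.
  by rewrite normcM normcV zr ler_pM2r ?invr_gt0// fB.
Qed.

End MeanValueProperty.

(** * Differentiability of the derivative and of the difference quotient *)

Section Regularity.
Variable R : realType.
Local Notation C := R[i].
Implicit Types (f g : C -> C) (z w d : C).

(** The intervals of radius [mu h] about [phi h] meet pairwise, so the supremum of their left ends
    belongs to all of them. *)
Lemma linear_rate_limit_real (T : Type) (D : set T) (phi mu : T -> R) :
  (D !=set0)%classic ->
  (forall h k, D h -> D k -> `|phi h - phi k| <= mu h + mu k) ->
  exists A, forall h, D h -> `|phi h - A| <= mu h.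
Proof.
move=> [h0 Dh0] H; pose S := ((fun h => phi h - mu h) @` D)%classic.
have ubS k : D k -> ubound S (phi k + mu k).
  move=> Dk _ [h Dh <-]; have := H h k Dh Dk; rewrite ler_norml; lra.
have hS : has_sup S by split; [exists (phi h0 - mu h0), h0|exists (phi h0 + mu h0); exact: ubS].
exists (sup S) => h Dh.
have h1 : phi h - mu h <= sup S by apply: sup_upper_bound => //; exists h.
have h2 : sup S <= phi h + mu h by apply: ge_sup; [case: hS|exact: ubS].
by rewrite ler_norml; lra.
Qed.

(** Real and imaginary parts are treated separately, whence the factor 2. *)
Lemma linear_rate_limit (T : Type) (D : set T) (phi : T -> C) (mu : T -> R) :
  (D !=set0)%classic ->
  (forall h k, D h -> D k -> normc (phi h - phi k) <= mu h + mu k) ->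
  exists A, forall h, D h -> normc (phi h - A) <= 2 * mu h.
Proof.
move=> D0 H.
have [|A HA] := @linear_rate_limit_real _ D (fun h => complex.Re (phi h)) mu D0.
  move=> h k Dh Dk; rewrite -ReN -ReD.
  exact: le_trans (Re_le_normc _) (H _ _ Dh Dk).
have [|B HB] := @linear_rate_limit_real _ D (fun h => complex.Im (phi h)) mu D0.
  move=> h k Dh Dk; rewrite -ImN -ImD.
  exact: le_trans (Im_le_normc _) (H _ _ Dh Dk).
exists (Complex A B) => h Dh; rewrite (le_trans (normc_le_ReIm _))//.
by rewrite ReD ReN ImD ImN /=; have := HA _ Dh; have := HB _ Dh; lra.
Qed.

Lemma normc_segment z0 z v (r t : R) : 0 <= t <= 1 ->
  normc (z - z0) < r -> normc (z + v - z0) < r ->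
  normc (z + (t%:C)%C * v - z0) < r.
Proof.
move=> t01 zr vr.
have -> : z + (t%:C)%C * v - z0 =
    ((1 - t)%:C)%C * (z - z0) + (t%:C)%C * (z + v - z0).
  by rewrite rmorphB/= rmorph1; ring.
rewrite (le_lt_trans (le_normcD _ _))// !normcM !normc_real !ger0_norm; try lra.
have [->|t1] := eqVneq t 0; first by rewrite subr0 mul1r mul0r addr0.
have t0 : 0 < t by rewrite lt_neqAle eq_sym t1; case/andP: t01.
nra.
Qed.

Lemma normc_shift z0 z v : normc (z + v - z0) <= normc v + normc (z - z0).
Proof. by rewrite (_ : z + v - z0 = v + (z - z0)) ?le_normcD//; ring. Qed.

(* Cauchy's estimate is applied four times: it bounds [F], then differences of
   [F], hence gives a quadratic first-order remainder of [f] that is uniform in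
   the base point, and finally makes the difference quotients of [F] Cauchy. *)
Theorem derivative_derivable f (F : C -> C) z0 (r0 : R) : 0 < r0 ->
  (forall z, normc (z - z0) < r0 -> cderiv f z (F z)) ->
  exists d, cderiv F z0 d.
Proof.
move=> r00 fF.
have [t t0 ht] := cderiv_cont (fF z0 ltac:(by rewrite subrr normc0)) ltr01.
(* Eight steps of length [p] leave room for estimates on the discs of radius [8 * p], [6 * p],
   [3 * p] and [2 * p] about [z0]. *)
pose p := Num.min t r0 / 8.
have p0 : 0 < p by rewrite divr_gt0// lt_min t0.
have p8t : 8 * p <= t by rewrite mulrC divfK// ge_min lexx.
have p8r : 8 * p <= r0 by rewrite mulrC divfK// ge_min lexx orbT.
have tri u z : normc (u - z0) <= normc (u - z) + normc (z - z0) by exact: normc_triangle.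
have diff z : normc (z - z0) < 8 * p -> cderiv f z (F z) by move=> zp; apply: fF; lra.
(* Within [t] of [z0] the values of [f] stay within 1 of [f z0], so any two of them differ by at
   most 2. *)
pose M1 := 2 / p.
have FB z : normc (z - z0) < 6 * p -> normc (F z) <= M1.
  move=> z6; apply: (@cauchy_estimate _ f z (F z) (2 * p) p 2).
  - by lra.
  - by move=> u u2; exists (F u); apply: diff; have := tri u z; lra.
  - by apply: diff; lra.
  - move=> u up; have zt := ht z ltac:(lra); have ut := ht u ltac:(have := tri u z; lra).
    by have := normc_triangle (f z0) (f u) (f z); rewrite (normcBC (f z0)); lra.
have M10 : 0 <= M1 by rewrite divr_ge0// ltW.
have fLip z h : normc (z - z0) < 6 * p -> normc (z + h - z0) < 6 * p ->
    normc (f (z + h) - f z) <= M1 * normc h.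
  move=> z6 h6; apply: mean_value_inequality => // s s01.
  have s6 := normc_segment s01 z6 h6.
  by exists (F (z + (s%:C)%C * h)); [apply: diff; lra|exact: FB].
pose M2 := 2 * M1 / p.
have M20 : 0 <= M2 by rewrite divr_ge0 ?(ltW p0)// mulr_ge0.
(* Cauchy's estimate for the increment [f (u + h) - f u], which [fLip] bounds and whose derivative
   at [z] is [F (z + h) - F z]. *)
have FLip z h : normc (z - z0) < 3 * p -> normc (z + h - z0) < 3 * p ->
    normc (F (z + h) - F z) <= M2 * normc h.
  move=> z3 h3.
  have hu u : normc (u - z) < 2 * p -> normc (u - z0) < 5 * p /\ normc (u + h - z0) < 5 * p.
    move=> u2; split; first by have := tri u z; lra.
    have := normc_triangle (z + h) (u + h) z0.
    by rewrite (_ : u + h - (z + h) = u - z); [lra|ring].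
  have -> : M2 * normc h = (2 * M1 * normc h) / p by rewrite /M2; field; rewrite gt_eqF.
  apply: (@cauchy_estimate _ (fun u => f (u + h) - f u) z _ (2 * p) p).
  - by lra.
  - move=> u /hu[u5 uh5]; eexists; apply: cderivB.
      by apply: cderiv_shift; apply: diff; lra.
    by apply: diff; lra.
  - by apply: cderivB; [apply: cderiv_shift|]; apply: diff; lra.
  - move=> u up; have [u5 uh5] := hu u ltac:(lra).
    have := fLip u h ltac:(lra) ltac:(lra); have := fLip z h ltac:(lra) ltac:(lra).
    by have := normcB (f (u + h) - f u) (f (z + h) - f z); lra.
(* The function [f u - F z * u] has derivative [F u - F z], controlled along the segment by
   [FLip]. *)
have f2 z h : normc (z - z0) < 3 * p -> normc (z + h - z0) < 3 * p ->
    normc (f (z + h) - f z - F z * h) <= M2 * normc h * normc h.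
  move=> z3 h3.
  rewrite (_ : _ - F z * h = (f (z + h) - F z * (z + h)) - (f z - F z * z)); last by ring.
  apply: (@mean_value_inequality _ (fun u => f u - F z * u)).
    by rewrite mulr_ge0// normc_ge0.
  move=> s s01; have s3 := normc_segment s01 z3 h3.
  exists (F (z + (s%:C)%C * h) - (0 * (z + (s%:C)%C * h) + F z * 1)).
    apply: cderivB; first by apply: diff; lra.
    by apply: cderivM; [exact: cderiv_cst|exact: cderiv_id].
  rewrite mul0r add0r mulr1 (le_trans (FLip _ _ z3 s3))// ler_wpM2l//.
  rewrite normcM normc_real ger0_norm; last by lra.
  by have := normc_ge0 h; nra.
pose D h := (F (z0 + h) - F z0) / h; pose K := 2 * M2 / p.
have K0 : 0 <= K by rewrite divr_ge0 ?(ltW p0)// mulr_ge0.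
pose S := [set h : C | 0 < normc h < p]%classic.
have quot u h : normc (u - z0) < 2 * p -> S h ->
    normc ((f (u + h) - f u) / h - F u) <= M2 * normc h.
  move=> u2 /andP[h0 hp]; have h0' : h != 0 by rewrite -normc_gt0.
  have := f2 u h ltac:(lra) ltac:(have := normc_shift z0 u h; lra).
  rewrite -ler_pdivrMr// -normcV -normcM.
  by rewrite (_ : (_ - F u * h) / h = (f (u + h) - f u) / h - F u)//; field.
have [|h k Sh Sk|A HA] := @linear_rate_limit _ S D (fun h => K * normc h).
- exists ((p / 2)%:C)%C; suff : 0 < normc ((p / 2)%:C)%C < p by [].
  by rewrite normc_real ger0_norm; lra.
- have -> : K * normc h + K * normc k = (2 * (M2 * normc h + M2 * normc k)) / p.
    by rewrite /K; field; rewrite gt_eqF.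
  (* The derivative of [G] at [z0] is [D h - D k], so a bound on [G] over a circle bounds the
     difference of two quotients of [F]. *)
  pose G u := (f (u + h) - f u) / h - (f (u + k) - f u) / k.
  have GB u : normc (u - z0) < 2 * p -> normc (G u) <= M2 * normc h + M2 * normc k.
    move=> u2; have h1 := quot u h u2 Sh; have h2 := quot u k u2 Sk.
    have := normcB ((f (u + h) - f u) / h - F u) ((f (u + k) - f u) / k - F u).
    by rewrite (_ : _ - F u - (_ - F u) = G u); [lra|rewrite /G; ring].
  have Gd u : normc (u - z0) < 2 * p ->
      cderiv G u ((F (u + h) - F u) / h - (F (u + k) - F u) / k).
    have part l : S l -> normc (u - z0) < 2 * p ->
        cderiv (fun u => (f (u + l) - f u) / l) u ((F (u + l) - F u) / l).
      move=> /andP[_ lp] u2.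
      have ul : normc (u + l - z0) < 8 * p.
        by have := normc_shift z0 u l; lra.
      have u8 : normc (u - z0) < 8 * p by lra.
      apply: cderiv_eq (cderivM (cderivB (cderiv_shift (diff _ ul)) (diff _ u8))
        (cderiv_cst l^-1 u)) _.
      by rewrite mulr0 addr0.
    by move=> u2; apply: cderivB; exact: part.
  apply: (@cauchy_estimate _ G z0 _ (2 * p) p).
  + by lra.
  + by move=> u /Gd; eexists; eassumption.
  + by apply: Gd; rewrite subrr normc0 mulr_gt0.
  + move=> u up; have := normcB (G u) (G z0).
    by have := GB u ltac:(lra); have := GB z0 ltac:(rewrite subrr normc0; lra); lra.
- exists A => e e0.
  have K1 : 0 < 2 * K + 1 by lra.
  exists (Num.min p (e / (2 * K + 1))) => [|w]; first by rewrite lt_min p0 divr_gt0.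
  rewrite lt_min => /andP[wp]; rewrite ltr_pdivlMr//.
  have [->|wz] := eqVneq w z0; first by rewrite !subrr mulr0 subr0 normc0 mulr0.
  have wz0 : w - z0 != 0 by rewrite subr_eq0.
  have n0 : 0 < normc (w - z0) by rewrite normc_gt0.
  have Sw : S (w - z0) by apply/andP.
  move=> we; have := HA _ Sw.
  rewrite /D (_ : z0 + (w - z0) = w); last by ring.
  move=> hA.
  have -> : F w - F z0 - A * (w - z0) = ((F w - F z0) / (w - z0) - A) * (w - z0).
    by field.
  rewrite normcM ler_wpM2r ?normc_ge0// (le_trans hA)//; lra.
Qed.

(** This removes the singularity of the difference quotient at its centre; the value [d / 2] is the
    second Taylor coefficient. *)
Lemma cderiv_dquot_center f (F : C -> C) z0 d (r0 : R) : 0 < r0 ->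
  (forall z, normc (z - z0) < r0 -> cderiv f z (F z)) -> cderiv F z0 d ->
  cderiv (dquot f z0 (F z0)) z0 (d / 2).
Proof.
move=> r00 fF Fd e e0; have [t t0 ht] := Fd e e0.
exists (Num.min t r0) => [|w]; first by rewrite lt_min t0.
rewrite lt_min => /andP[wt wr].
rewrite /dquot eqxx; have [->|wz] := eqVneq w z0.
  by rewrite !subrr mulr0 subr0 normc0 mulr0.
have wz0 : w - z0 != 0 by rewrite subr_eq0.
have n0 : 0 < normc (w - z0) by rewrite normc_gt0.
(* The second-order Taylor remainder up to a constant: its derivative [F u - F z0 - d * (u - z0)] is
   small relative to [w - z0] on the segment. *)
pose k u := f u - (F z0 * u + d / 2 * ((u - z0) * (u - z0))).
have -> : (f w - f z0) / (w - z0) - F z0 - d / 2 * (w - z0) = (k w - k z0) / (w - z0).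
  by rewrite /k; field.
rewrite normcM normcV ler_pdivrMr//.
have -> : k w = k (z0 + (w - z0)) by rewrite addrC subrK.
apply: mean_value_inequality; first by rewrite mulr_ge0 ?(ltW e0)// ltW.
move=> s /andP[s0 s1]; set u := z0 + _.
have uz : u - z0 = (s%:C)%C * (w - z0) by rewrite /u; ring.
have un : normc (u - z0) <= normc (w - z0).
  by rewrite uz normcM normc_real ger0_norm// ler_piMl// normc_ge0.
exists (F u - F z0 - d * (u - z0)); last first.
  by rewrite (le_trans (ht _ (le_lt_trans un wt)))// ler_wpM2l// ltW.
have sd : cderiv (fun u => u - z0) u 1.
  by have := cderivB (cderiv_id u) (cderiv_cst z0 u); rewrite subr0.
apply: cderiv_eq.
  apply: cderivB (fF _ (le_lt_trans un wr)) _.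
  apply: cderivD (cderivM (cderiv_cst _ _) (cderiv_id _)) _.
  exact: cderivM (cderiv_cst _ _) (cderivM sd sd).
by rewrite /=; field.
Qed.

End Regularity.

(** * Minima on compact sets, first exit, maximum principle, boundary derivative *)

Section Extremum.
Variable R : realType.
Local Notation C := R[i].
Implicit Types (f g h : C -> C) (z w d : C).

(** Without a minimum, each point has a neighbourhood on which [phi] stays above its value at some
    [c] in [S]. Taking the lowest of four such values passes this to larger squares, and on the
    whole square [c] contradicts itself. *)
Lemma compact_lsc_min (S : C -> Prop) (phi : C -> R) (M : R) :
  (exists z, S z) -> (forall z, S z -> normc z <= M) ->
  (forall W, ~ S W -> exists2 t : R, 0 < t & forall z, normc (z - W) < t -> ~ S z) ->
  (forall W, S W -> forall e : R, 0 < e -> exists2 t : R, 0 < t &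
    forall z, S z -> normc (z - W) < t -> phi W - e <= phi z) ->
  exists W, S W /\ forall z, S z -> phi W <= phi z.
Proof.
move=> [z1 Sz1] SM Sclosed lsc; apply: contrapT => nomin.
have lower W : S W -> exists2 c, S c & phi c < phi W.
  move=> SW; apply: contrapT => H; apply: nomin; exists W; split => // z Sz.
  by rewrite leNgt; apply/negP => zW; apply: H; exists z.
have M0 : 0 <= M by rewrite (le_trans (normc_ge0 z1))// SM.
have M20 : 0 <= 2 * M by lra.
have [c Sc Hc] : exists2 c, S c & forall z, S z ->
    - M <= complex.Re z <= - M + 2 * M / 2 ^+ 0 ->
    - M <= complex.Im z <= - M + 2 * M / 2 ^+ 0 -> phi c < phi z.
  apply: (bisection (P := fun x y k => exists2 c, S c & forall z, S z ->
    x <= complex.Re z <= x + 2 * M / 2 ^+ k ->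
    y <= complex.Im z <= y + 2 * M / 2 ^+ k -> phi c < phi z) M20 M20).
  - move=> x y k H.
    have [c1 S1 h1] := H false false; have [c2 S2 h2] := H true false.
    have [c3 S3 h3] := H false true; have [c4 S4 h4] := H true true.
    have low c c' : S c -> S c' -> exists2 c0, S c0 & phi c0 <= phi c /\ phi c0 <= phi c'.
      move=> Sc Sc'; have [cc|/ltW cc] := lerP (phi c) (phi c'); first by exists c.
      by exists c'.
    have [c5 S5 [l1 l2]] := low _ _ S1 S2; have [c6 S6 [l3 l4]] := low _ _ S3 S4.
    have [c7 S7 [l5 l6]] := low _ _ S5 S6; exists c7 => // z Sz.
    move: {H h1 h2 h3 h4}(h1 z Sz) (h2 z Sz) (h3 z Sz) (h4 z Sz).
    rewrite !mul0r !mul1r !addr0.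
    have -> : 2 * M / 2 ^+ k = 2 * M / 2 ^+ k.+1 + 2 * M / 2 ^+ k.+1.
      by rewrite exprS; field; rewrite expf_neq0.
    move: (complex.Re z) (complex.Im z) (2 * M / 2 ^+ k.+1) => X Y L.
    move=> h1 h2 h3 h4 hX hY.
    have [cX|cX] := lerP X (x + L); have [cY|cY] := lerP Y (y + L).
    + by have := h1 ltac:(lra) ltac:(lra); lra.
    + by have := h3 ltac:(lra) ltac:(lra); lra.
    + by have := h2 ltac:(lra) ltac:(lra); lra.
    + by have := h4 ltac:(lra) ltac:(lra); lra.
  - move=> X Y hX hY; set W := Complex X Y.
    suff [t t0 [c Sc H]] : exists2 t : R, 0 < t & exists2 c, S c &
        forall z, S z -> normc (z - W) < t -> phi c < phi z.
      exists t => // k x y xX yY Lt; exists c => // z Sz zx zy; apply: H => //.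
      apply: le_lt_trans Lt; rewrite (le_trans (normc_le_ReIm _))// mulrDl.
      by rewrite lerD// ?ReD ?ReN ?ImD ?ImN ler_norml /=; lra.
    have [SW|nSW] := pselect (S W); last first.
      have [t t0 ht] := Sclosed _ nSW; exists t => //.
      by exists z1 => // z Sz /ht.
    have [c Sc cW] := lower _ SW; have h : 0 < (phi W - phi c) / 2 by lra.
    have [t t0 ht] := lsc _ SW _ h; exists t => //.
    by exists c => // z Sz /ht => /(_ Sz); lra.
suff : phi c < phi c by rewrite ltxx.
have := SM _ Sc; have := Re_le_normc c; have := Im_le_normc c.
by rewrite !ler_norml => h1 h2 h3; apply: Hc => //; rewrite expr0 divr1; lra.
Qed.

Definition rcont (phi : C -> R) z := forall e : R, 0 < e -> exists2 t : R, 0 < t &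
  forall w, normc (w - z) < t -> `|phi w - phi z| < e.

Lemma ccont_Re f z : ccont f z -> rcont (fun w => complex.Re (f w)) z.
Proof.
move=> fc e /fc[t t0 ht]; exists t => // w /ht; apply: le_lt_trans.
by rewrite -ReN -ReD Re_le_normc.
Qed.

Lemma normcB_le z w : `|normc z - normc w| <= normc (z - w).
Proof.
rewrite ler_norml; have := normc_lerB z w; have := normc_lerB w z.
by rewrite (normcBC w); lra.
Qed.

Lemma ccont_normc f z : ccont f z -> rcont (fun w => normc (f w)) z.
Proof.
by move=> fc e /fc[t t0 ht]; exists t => // w /ht; apply: le_lt_trans; exact: normcB_le.
Qed.

(** Among the points with [phi <= 0] and modulus at most [normc z1], one is nearest to the origin.
    Were [phi] negative there, continuity would give a nearer one on the same ray. *)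
Lemma first_exit (phi : C -> R) z1 : normc z1 < 1 -> phi z1 <= 0 -> 0 < phi 0 ->
  (forall z, normc z < 1 -> rcont phi z) ->
  exists z0, [/\ normc z0 < 1, z0 != 0, phi z0 = 0 &
    forall z, normc z < normc z0 -> 0 < phi z].
Proof.
move=> z11 phi1 phi0 pc.
pose S z := normc z <= normc z1 /\ phi z <= 0.
have [||||z0 [[z01 pz0] z0min]] := @compact_lsc_min S (@normc R) (normc z1).
- by exists z1.
- by move=> z [].
- move=> W nSW; have [Wz1|Wz1] := lerP (normc W) (normc z1); last first.
    exists (normc W - normc z1); first by rewrite subr_gt0.
    move=> z zW [zz1 _]; have := normc_lerB W z; rewrite normcBC; lra.
  have pW : 0 < phi W by rewrite ltNge; apply/negP => pW; apply: nSW.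
  have [t t0 ht] := pc W (le_lt_trans Wz1 z11) _ pW.
  by exists t => // z /ht zW [_ pz]; move: zW; rewrite ltr_norml; lra.
- move=> W _ e e0; exists e => // z _ zW.
  by have := normc_lerB W z; rewrite normcBC; lra.
have z0lt : normc z0 < 1 by exact: le_lt_trans z01 z11.
have inside z : normc z < normc z0 -> 0 < phi z.
  move=> zz0; rewrite ltNge; apply/negP => pz.
  have := z0min z (conj (le_trans (ltW zz0) z01) pz); lra.
have z00 : z0 != 0 by apply: contraTneq pz0 => ->; rewrite -ltNge.
have n0 : 0 < normc z0 by rewrite normc_gt0.
exists z0; split => //; apply/eqP; rewrite eq_le pz0 leNgt; apply/negP => pneg.
have [t t0 ht] := pc z0 z0lt (- phi z0) ltac:(lra).
pose s := Num.min (1 / 2) (t / (2 * normc z0)).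
have s0 : 0 < s by rewrite lt_min divr_gt0 ?divr_gt0// mulr_gt0.
have s1 : s <= 1 / 2 by rewrite ge_min lexx.
have st : s * normc z0 <= t / 2.
  have : s <= t / (2 * normc z0) by rewrite ge_min lexx orbT.
  rewrite ler_pdivlMr ?mulr_gt0//; lra.
have := ht (((1 - s)%:C)%C * z0); rewrite rmorphB/= rmorph1.
rewrite (_ : (1 - (s%:C)%C) * z0 - z0 = (((- s)%:C)%C) * z0); last by rewrite rmorphN/=; ring.
rewrite normcM normc_real normrN gtr0_norm// => /(_ ltac:(lra)).
have := inside (((1 - s)%:C)%C * z0); rewrite normcM normc_real gtr0_norm; last by lra.
rewrite rmorphB/= rmorph1 => /(_ ltac:(nra)); rewrite ltr_norml; lra.
Qed.

(* Adding [e * |z| ^ 2] makes an interior maximum of [|h|] strict enough to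
   contradict the mean value property. *)
Lemma maximum_principle h (p B : R) : 0 < p < 1 ->
  (forall z, normc z < 1 -> exists d, cderiv h z d) ->
  (forall z, normc z = p -> normc (h z) <= B) ->
  forall z, normc z <= p -> normc (h z) <= B.
Proof.
move=> /andP[p0 p1] hd hB z1 z1p; rewrite leNgt; apply/negP => Bz1.
(* With this [e], [normc (h z1)] exceeds [B + e * p ^+ 2], so the perturbed maximum cannot lie on
   the circle of radius [p]. *)
pose e := (normc (h z1) - B) / (p ^+ 2 + 1).
have pp : 0 < p ^+ 2 + 1 by have := sqr_ge0 p; lra.
have e0 : 0 < e by rewrite divr_gt0// subr_gt0.
have eE : normc (h z1) = B + e * p ^+ 2 + e.
  by rewrite /e; field; rewrite gt_eqF.
have hc z : normc z < 1 -> ccont h z by move=> /hd[d]; exact: cderiv_cont.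
pose phi z := - (normc (h z) + e * normc z ^+ 2).
pose S z := normc z <= p.
have idc (z : C) : ccont id z by move=> t t0; exists t.
have phic W : S W -> rcont phi W.
  move=> SW a a0; have a40 : 0 < a / 2 by rewrite divr_gt0.
  have [t t0 ht] := ccont_normc (hc W (le_lt_trans SW p1)) a40.
  have b0 : 0 < a / 2 / (e * (2 * normc W + 1)).
    by rewrite divr_gt0// mulr_gt0//; have := normc_ge0 W; lra.
  exists (Num.min (Num.min t 1) (a / 2 / (e * (2 * normc W + 1)))) => [|z].
    by rewrite !lt_min t0 ltr01.
  rewrite !lt_min => /andP[/andP[/ht h1 z1'] h2].
  have WW := normc_ge0 W; have zz := normc_ge0 z.
  move: h2; rewrite ltr_pdivlMr; last by rewrite mulr_gt0//; lra.
  have := normcB_le z W; move: h1 z1'; rewrite /phi; set u := normc (z - W).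
  rewrite !ltr_norml !ler_norml => h1 u1 hz h2.
  have e1 : e * `|normc z ^+ 2 - normc W ^+ 2| < a / 2.
    apply: le_lt_trans h2; rewrite mulrCA ler_wpM2l ?(ltW e0)//.
    rewrite subr_sqr normrM ler_pM ?normr_ge0 ?ler_norml; lra.
  have := ler_norm (normc z ^+ 2 - normc W ^+ 2).
  have := ler_norm (- (normc z ^+ 2 - normc W ^+ 2)); rewrite normrN; nra.
have [||||W [SW Wmin]] := @compact_lsc_min S phi p.
- by exists z1.
- by [].
- move=> W /negP; rewrite -ltNge => pW; exists (normc W - p); first by rewrite subr_gt0.
  move=> z zW Sz; have := normc_lerB W z; rewrite normcBC; move: Sz; rewrite /S; lra.
- move=> W /phic Wc a a0; have [t t0 ht] := Wc a a0; exists t => // z _ /ht.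
  by rewrite ltr_norml; lra.
have Wz1 := Wmin z1 z1p; have W0 := normc_ge0 W; have z10 := normc_ge0 z1.
have Wp : normc W < p.
  rewrite lt_neqAle (SW : normc W <= p) andbT; apply/eqP => Wp.
  move: Wz1; rewrite /phi Wp; have := hB W Wp; have := sqr_ge0 (normc z1); nra.
have W1 : normc W < 1 by lra.
pose r := (p - normc W) / 2; have r0 : 0 < r by rewrite /r; lra.
have [c c1 ch] := unimodular_rotation (h W).
(* On a circle about [W], [normc z ^+ 2] is a constant plus twice the real part of the conjugate of
   [W] times [z - W]. The linear term thus carries the perturbation holomorphically and leaves a
   gain of [e * r ^+ 2]. *)
pose k z := c * h z + 2 * (e%:C)%C * (W^*)%C * (z - W).
have inside z : normc (z - W) < 2 * r -> normc z < p.
  by have := normc_lerB z W; rewrite /r; lra.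
have kd z : normc (z - W) < 2 * r -> exists d, cderiv k z d.
  move=> /inside zp; have [d hd'] := hd z ltac:(lra); eexists.
  apply: cderivD (cderivM (cderiv_cst c z) hd') _.
  exact: cderivM (cderiv_cst _ _) (cderivB (cderiv_id z) (cderiv_cst W z)).
suff : complex.Re (k W) <= normc (h W) - e * r ^+ 2.
  rewrite /k subrr mulr0 addr0 ch /=; have : 0 < e * r ^+ 2 by rewrite mulr_gt0 ?exprn_gt0.
  lra.
apply: (@mean_halfplane _ k W (2 * r) r).
- by lra.
- by move=> z /andP[_ /kd].
- by have [|d] := kd W; [rewrite subrr normc0; lra|exact: cderiv_cont].
- move=> z zr; have zp := inside z ltac:(lra).
  have := Wmin z (ltW zp); rewrite /phi => hz.
  have h1 : complex.Re (c * h z) <= normc (h z).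
    by rewrite (le_trans (ler_norm _))// (le_trans (Re_le_normc _))// normcM c1 mul1r.
  have n2 : normc z ^+ 2 = normc W ^+ 2 + 2 * complex.Re ((W^*)%C * (z - W)) + r ^+ 2.
    rewrite -zr !sqr_normc_ReIm !(ReM, ImM, ReD, ReN, ImD, ImN).
    by case: (W) => a b /=; ring.
  have -> : k z = c * h z + ((2 * e)%:C)%C * ((W^*)%C * (z - W)).
    have -> : ((2 * e)%:C)%C = 2 * (e%:C)%C :> C by rewrite rmorphM rmorph_nat.
    by rewrite /k !mulrA.
  move: hz n2; rewrite ReD [complex.Re (_%:C%C * _)]ReM /= mul0r subr0.
  by move=> hz n2; rewrite n2 in hz; lra.
Qed.

(** Moving from [z0] to [z0 * (1 + s * u)] with [u = -1 + i y] enters the smaller disc for small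
    [s > 0], so the first-order change of the real part cannot be negative. All slopes [y] together
    force the conclusion. *)
Lemma boundary_half_plane g z0 d : z0 != 0 -> cderiv g z0 d ->
  complex.Re (g z0) = 0 ->
  (forall z, normc z < normc z0 -> 0 <= complex.Re (g z)) ->
  complex.Im (z0 * d) = 0 /\ complex.Re (z0 * d) <= 0.
Proof.
move=> z00 gd g0 gpos; set a := z0 * d.
have n0 : 0 < normc z0 by rewrite normc_gt0.
have dir y : complex.Re a + y * complex.Im a <= 0.
  rewrite leNgt; apply/negP; set c := _ + _ => c0.
  pose u : C := Complex (-1) y.
  have u0 : 0 < normc u.
    by rewrite normc_gt0 eq_complex /= oppr_eq0 oner_eq0.
  have e0 : 0 < c / (2 * normc z0 * normc u) by rewrite divr_gt0// !mulr_gt0.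
  have [t t0 ht] := gd _ e0.
  (* The first bound keeps [w] within [t] of [z0]; the second makes the squared modulus of
     [1 + s * u] at most [1 - s]. *)
  pose s := Num.min (t / (2 * normc z0 * normc u)) (1 / normc u ^+ 2).
  have s0 : 0 < s by rewrite lt_min !divr_gt0 ?mulr_gt0 ?exprn_gt0.
  have s1 : s * (normc z0 * normc u) <= t / 2.
    have : s <= t / (2 * normc z0 * normc u) by rewrite ge_min lexx.
    rewrite ler_pdivlMr ?mulr_gt0//; lra.
  have s2 : s * normc u ^+ 2 <= 1.
    have : s <= 1 / normc u ^+ 2 by rewrite ge_min lexx orbT.
    by rewrite ler_pdivlMr ?exprn_gt0.
  pose w := z0 * (1 + (s%:C)%C * u).
  have wz : w - z0 = z0 * ((s%:C)%C * u) by rewrite /w; ring.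
  have wn : normc (w - z0) = s * (normc z0 * normc u).
    by rewrite wz !normcM normc_real gtr0_norm//; ring.
  have := ht w; rewrite wn => /(_ ltac:(lra)).
  have -> : c / (2 * normc z0 * normc u) * (s * (normc z0 * normc u)) = s * c / 2.
    by field; rewrite !gt_eqF.
  have := Re_le_normc (g w - g z0 - d * (w - z0)).
  have -> : d * (w - z0) = (s%:C)%C * (a * u) by rewrite wz /a; ring.
  have : normc w < normc z0.
    rewrite /w normcM gtr_pMr// -(ltr_pXn2r (ltn0Sn 1)) ?nnegrE ?normc_ge0// expr1n.
    have nu : normc u ^+ 2 = 1 + y ^+ 2 by rewrite sqr_normc_ReIm /= sqrrN expr1n.
    have : s * (s * (1 + y ^+ 2)) <= s by rewrite -nu ler_piMr// ltW.
    rewrite (sqr_normc_ReIm (1 + _)) !(ReM, ImM, ReD, ImD) /=; lra.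
  move=> /gpos; rewrite ler_norml !ReD !ReN
    [complex.Re (_%:C%C * _)]ReM [complex.Re (a * u)]ReM /= g0.
  have : 0 < s * c by rewrite mulr_gt0.
  rewrite /c; lra.
have Im0 : complex.Im a = 0.
  (* This slope makes the form in [dir] equal to 1. *)
  apply/eqP; apply: contraT => I0; have := dir ((1 - complex.Re a) / complex.Im a).
  by rewrite divfK//; lra.
by split => //; have := dir 0; rewrite mul0r addr0.
Qed.

End Extremum.

(** * Holomorphic functions on the unit disc, Schwarz and Jack lemmas *)

Section DiscFunctions.
Variable R : realType.
Local Notation C := R[i].
Implicit Types (f g h : C -> C) (z d : C).

Definition holo f := forall z, normc z < 1 -> exists d, cderiv f z d.

Lemma holo_derivative f : holo f ->
  exists2 F, (forall z, normc z < 1 -> cderiv f z (F z)) & holo F.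
Proof.
move=> hf; have total z : exists d, normc z < 1 -> cderiv f z d.
  have [/hf[d hd]|z1] := ltrP (normc z) 1; first by exists d.
  by exists 0.
have [F hF] := boolp.choice total.
exists F => // z z1; apply: (derivative_derivable (r0 := 1 - normc z) (f := f)); first by lra.
by move=> w wz; apply: hF; have := normc_lerB w z; lra.
Qed.

(** The cofactor is the difference quotient at the origin, whose differentiability there rests on
    that of the derivative. *)
Lemma holo_factor f : holo f -> exists g, [/\ holo g, cderiv f 0 (g 0) &
  forall z, f z = f 0 + z * g z].
Proof.
move=> hf; have [F fF hF] := holo_derivative hf.
have D0 : normc (0 : C) < 1 by rewrite normc0.
exists (dquot f 0 (F 0)); split.
- move=> z z1; have [->|z0] := eqVneq z 0.
    have [d hd] := hF 0 D0; exists (d / 2).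
    by apply: (cderiv_dquot_center (r0 := 1)) => // w; rewrite subr0; exact: fF.
  by eexists; apply: cderiv_dquot => //; exact: fF.
- by rewrite /dquot eqxx; exact: fF.
- move=> z; rewrite /dquot; case: eqVneq => [->|z0]; first by rewrite mul0r addr0.
  by rewrite !subr0; field.
Qed.

Lemma Re_inv z : complex.Re z^-1 = complex.Re z / normc z ^+ 2.
Proof. by rewrite sqr_normc_ReIm; case: z. Qed.

(** Inversion maps the circle of radius 1 about 1, without 0, to the line of real part [1 / 2]. *)
Lemma Re_1_sub_inv z : z != 0 -> normc (z - 1) = 1 ->
  complex.Re (1 - z^-1) = 1 / 2.
Proof.
move=> z0 n1; have n0 : normc z ^+ 2 != 0 by rewrite expf_neq0// normc_eq0.
move: n1 => /(congr1 (fun x => x ^+ 2)); rewrite expr1n sqr_normc_ReIm.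
rewrite !ReD !ReN Re_inv ImD ImN /= oppr0 addr0 => n1; move: n0.
have -> : normc z ^+ 2 = 2 * complex.Re z.
  by rewrite sqr_normc_ReIm; move: n1; rewrite !expr2; lra.
by rewrite mulf_eq0 negb_or => /andP[_ n0]; field.
Qed.

(** The maximum principle gives [normc (h z) <= 1 / p ^+ 2] for every [p < r] with [normc z <= p]; a
    violation at [z] is refuted by a [p] close enough to [r]. *)
Lemma schwarz_order2 h (r : R) : holo h -> 0 < r < 1 ->
  (forall z, normc z < r -> normc z ^+ 2 * normc (h z) <= 1) ->
  forall z, normc z < r -> r ^+ 2 * normc (h z) <= 1.
Proof.
move=> hh /andP[r0 r1] hB z zr; rewrite leNgt; apply/negP => hz.
have h0 : 0 < normc (h z).
  rewrite lt_neqAle normc_ge0 andbT; apply: contraTneq hz => <-.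
  by rewrite mulr0 -leNgt ler01.
(* As [normc (h z) * (b * r) = 1], a radius with [p ^+ 2 > b * r] is needed. The mean of [b] and [r]
   qualifies by the arithmetic-geometric inequality, without a square root. *)
pose b := 1 / (normc (h z) * r).
have bE : normc (h z) * (b * r) = 1 by rewrite /b; field; rewrite !gt_eqF.
have b0 : 0 < b by rewrite divr_gt0// mulr_gt0.
have br : b < r.
  rewrite /b ltr_pdivrMr ?mulr_gt0//; move: hz; rewrite expr2; lra.
pose p := Num.max (normc z) ((b + r) / 2).
have pz : normc z <= p by rewrite le_max lexx.
have pb : (b + r) / 2 <= p by rewrite le_max lexx orbT.
have pr : p < r by rewrite gt_max zr; lra.
have p0 : 0 < p by lra.
have := @maximum_principle _ h p (1 / p ^+ 2) _ hh _ z pz.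
rewrite ler_pdivlMr ?exprn_gt0//.
have p1 : 0 < p < 1 by rewrite p0; lra.
move=> /(_ p1) H; have {}H : normc (h z) * p ^+ 2 <= 1.
  apply: H => w wp; rewrite ler_pdivlMr ?exprn_gt0// mulrC -wp hB// wp//.
have : b * r < p ^+ 2.
  have : ((b + r) / 2) ^+ 2 <= p ^+ 2 by rewrite ler_pXn2r ?nnegrE//; lra.
  have : 0 < (r - b) ^+ 2 by rewrite exprn_gt0// subr_gt0.
  rewrite !expr2; lra.
rewrite -(ltr_pM2l h0) bE; lra.
Qed.

(* Jack's lemma for a double zero at the origin, the usual constant being [2 + c]. *)
Lemma jack_order2 w h z0 d : holo h -> (forall z, w z = z ^+ 2 * h z) ->
  z0 != 0 -> normc z0 < 1 -> normc (w z0) = 1 ->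
  (forall z, normc z < normc z0 -> normc (w z) <= 1) -> cderiv w z0 d ->
  exists2 c : R, 0 <= c & z0 * d = w z0 * (2 + (c%:C)%C).
Proof.
move=> hh wE z00 z01 w1 win wd.
have r0 : 0 < normc z0 by rewrite normc_gt0.
have hB := schwarz_order2 (r := normc z0) hh.
have {}hB z : normc z < normc z0 -> normc z0 ^+ 2 * normc (h z) <= 1.
  apply: hB; first by rewrite r0.
  by move=> u /win; rewrite wE normcM expr2 normcM.
have hz0 : normc z0 ^+ 2 * normc (h z0) = 1 by rewrite -w1 wE !expr2 !normcM.
have h00 : h z0 != 0.
  by apply: contra_eq_neq hz0 => ->; rewrite normc0 mulr0 eq_sym oner_eq0.
have n0 : 0 < normc (h z0) by rewrite normc_gt0.
have [dh hdh] := hh z0 z01.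
have dE : d = 2 * z0 * h z0 + z0 ^+ 2 * dh.
  apply: (cderiv_unique wd).
  apply: (cderiv_near (f := fun z => z * z * h z) (t := 1)) => //.
  by apply: cderiv_eq (cderivM (cderivM (cderiv_id _) (cderiv_id _)) hdh) _; rewrite /=; ring.
(* The function [1 - h z / h z0] vanishes at [z0] and has nonnegative real part on the smaller disc,
   so [z0 * dh / h z0] is real and nonnegative; this is the constant [c]. *)
have gd : cderiv (fun z => 1 - (h z0)^-1 * h z) z0 (- ((h z0)^-1 * dh)).
  apply: cderiv_eq (cderivB (cderiv_cst 1 z0) (cderivM (cderiv_cst (h z0)^-1 z0) hdh)) _.
  by rewrite mul0r !add0r.
have [||cI cR] := boundary_half_plane z00 gd.
- by rewrite mulVf// subrr.
- move=> z zr; rewrite ReD ReN /=.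
  have : normc ((h z0)^-1 * h z) <= 1.
    rewrite normcM normcV ler_pdivrMl// mulr1.
    by have := hB z zr; rewrite -hz0 ler_pM2l// exprn_gt0.
  by have := Re_le_normc ((h z0)^-1 * h z); rewrite ler_norml; lra.
exists (complex.Re (z0 * dh / h z0)).
  by move: cR; rewrite mulrN ReN mulrCA mulrC; lra.
have -> : ((complex.Re (z0 * dh / h z0))%:C)%C = z0 * dh / h z0.
  apply/eqP; rewrite eq_complex /= eqxx/=; move: cI.
  by rewrite mulrN ImN mulrCA mulrC => /eqP; rewrite oppr_eq0 eq_sym.
by rewrite dE wE; field.
Qed.

End DiscFunctions.

(** * The inclusion for [alpha <= -1] *)

Section AlphaConvex.
Variable R : realType.
Local Notation C := R[i].
Implicit Types (z w d : C).

(* [q], [p], [s] stand for [z / f], [(z / f) ^ 2 * f'], [z * f' / f], extended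
   to [0] by their limits. *)
Lemma alpha_convex_quotients (f F G : C -> C) :
  (forall z, normc z < 1 -> cderiv f z (F z)) ->
  (forall z, normc z < 1 -> cderiv F z (G z)) ->
  f 0 = 0 -> F 0 = 1 ->
  (forall z, normc z < 1 -> z != 0 -> f z != 0) ->
  (forall z, normc z < 1 -> z != 0 -> F z != 0) ->
  exists q q1 q2 : C -> C,
  [/\ forall z, normc z < 1 -> cderiv q z (q1 z),
      forall z, normc z < 1 -> cderiv q1 z (q2 z),
      q 0 = 1,
      forall z, normc z < 1 -> q z != 0 /\ q z - z * q1 z != 0 &
      forall z, normc z < 1 -> z != 0 ->
        [/\ f z = z / q z, F z = (q z - z * q1 z) / q z ^+ 2 &
            G z = (- z * q2 z * q z - 2 * (q z - z * q1 z) * q1 z) / q z ^+ 3]].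
Proof.
move=> fF FG f0 F0 fn0 Fn0.
have D0 : normc (0 : C) < 1 by rewrite normc0.
have hf : holo f by move=> z /fF; exists (F z).
have [P [hP fP PE]] := holo_factor hf.
have P0 : P 0 = 1 by rewrite -F0; apply: cderiv_unique fP (fF 0 D0).
have {}PE z : f z = z * P z by rewrite PE f0 add0r.
have Pn0 z : normc z < 1 -> P z != 0.
  move=> z1; have [->|z0] := eqVneq z 0; first by rewrite P0 oner_eq0.
  by have := fn0 z z1 z0; rewrite PE mulf_eq0 negb_or => /andP[].
pose q z := (P z)^-1.
have hq : holo q.
  by move=> z z1; have [d hd] := hP z z1; eexists; apply: cderivV (Pn0 z z1) hd.
have [q1 qq1 hq1] := holo_derivative hq.
have [q2 q12 _] := holo_derivative hq1.
have qn0 z : normc z < 1 -> q z != 0 by move=> z1; rewrite invr_eq0 Pn0.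
have fE z : f z = z / q z by rewrite PE /q invrK.
have FE z : normc z < 1 -> F z = (q z - z * q1 z) / q z ^+ 2.
  move=> z1; apply: (cderiv_unique (fF z z1)).
  rewrite (_ : f = fun z => z / q z); last exact/funext.
  by apply: cderiv_eq (cderiv_div (qn0 z z1) (cderiv_id z) (qq1 z z1)) _; rewrite mul1r.
exists q, q1, q2; split => //; first by rewrite /q P0 invr1.
- move=> z z1; split; first exact: qn0.
  have [->|z0] := eqVneq z 0; first by rewrite mul0r subr0 qn0.
  by have := Fn0 z z1 z0; rewrite FE// mulf_eq0 negb_or => /andP[].
- move=> z z1 z0; have qz := qn0 z z1; split => //; first exact: FE.
  apply: (cderiv_unique (FG z z1)).
  apply: (cderiv_near (f := fun z => (q z - z * q1 z) / (q z * q z)) (t := 1 - normc z)).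
  + by lra.
  + move=> w wz; rewrite FE ?expr2//; have := normc_lerB w z; lra.
  + apply: cderiv_eq.
      apply: (@cderiv_div _ (fun z => q z - z * q1 z) (fun z => q z * q z) z).
      * by rewrite mulf_neq0.
      * exact: cderivB (qq1 z z1) (cderivM (cderiv_id z) (q12 z z1)).
      * exact: cderivM (qq1 z z1) (qq1 z z1).
    by rewrite /=; field.
Qed.

Theorem alpha_convex_bound (alpha : R) (f F G : C -> C) : alpha <= -1 ->
  (forall z, normc z < 1 -> cderiv f z (F z)) ->
  (forall z, normc z < 1 -> cderiv F z (G z)) ->
  f 0 = 0 -> F 0 = 1 ->
  (forall z, normc z < 1 -> z != 0 -> f z != 0) ->
  (forall z, normc z < 1 -> z != 0 -> F z != 0) ->
  (forall z, normc z < 1 -> z != 0 ->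
    0 < complex.Re ((1 - (alpha%:C)%C) * (z * F z / f z) +
                    (alpha%:C)%C * (1 + z * G z / F z))) ->
  forall z, normc z < 1 -> z != 0 -> normc ((z / f z) ^+ 2 * F z - 1) < 1.
Proof.
move=> al fF FG f0 F0 fn0 Fn0 pos.
have [q [q1 [q2 [qq1 q12 q0 qp rel]]]] := alpha_convex_quotients fF FG f0 F0 fn0 Fn0.
have D0 : normc (0 : C) < 1 by rewrite normc0.
pose p z := q z - z * q1 z; pose p1 z := - z * q2 z.
have pd z : normc z < 1 -> cderiv p z (p1 z).
  move=> z1; apply: cderiv_eq (cderivB (qq1 z z1) (cderivM (cderiv_id z) (q12 z z1))) _.
  by rewrite /p1 /=; ring.
pose s z := p z / q z; pose s1 z := (p1 z * q z - p z * q1 z) / q z ^+ 2.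
have sd z : normc z < 1 -> cderiv s z (s1 z).
  by move=> z1; apply: cderiv_div (pd z z1) (qq1 z z1); case: (qp z z1).
have p0 : p 0 = 1 by rewrite /p mul0r subr0.
have s0 : s 0 = 1 by rewrite /s p0 q0 divr1.
have posS z : normc z < 1 -> z != 0 ->
    0 < complex.Re (s z + (alpha%:C)%C * (z * s1 z / s z)).
  move=> z1 z0; have [fE FE GE] := rel z z1 z0; have [qz pz] := qp z z1.
  have := pos z z1 z0; rewrite fE FE GE /s /s1 /p /p1 => /lt_le_trans; apply.
  rewrite le_eqVlt; apply/orP; left; apply/eqP; congr complex.Re.
  by field; rewrite qz pz z0.
have posP z : normc z < 1 -> z != 0 ->
    0 < complex.Re ((1 + (alpha%:C)%C) * s z + (alpha%:C)%C * (z * p1 z / p z) - (alpha%:C)%C).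
  move=> z1 z0; have [qz pz] := qp z z1.
  have := posS z z1 z0; rewrite /s /s1 /p /p1 => /lt_le_trans; apply.
  rewrite le_eqVlt; apply/orP; left; apply/eqP; congr complex.Re.
  by field; rewrite qz pz.
have starlike z : normc z < 1 -> 0 < complex.Re (s z).
  move=> z1; rewrite ltNge; apply/negP => sz.
  have [|w w1|z0 [z01 z00 sz0 sin]] := @first_exit _ (fun z => complex.Re (s z)) z z1 sz.
  - by rewrite s0 ltr01.
  - exact: ccont_Re (cderiv_cont (sd w w1)).
  (* Here [z0 * s1 z0] is real and [s z0] imaginary, so their quotient adds nothing to the real part
     in [posS]. *)
  have [aI aR] := boundary_half_plane z00 (sd z0 z01) sz0 (fun z h => ltW (sin z h)).
  have := posS z0 z01 z00; rewrite ReD sz0 [complex.Re (_%:C%C * _)]ReM /= mul0r subr0.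
  by rewrite [complex.Re (_ / _)]ReM aI mul0r subr0 Re_inv sz0 mul0r !mulr0 addr0 ltxx.
have wd z : normc z < 1 -> cderiv (fun z => p z - 1) z (p1 z).
  by move=> z1; have := cderivB (pd z z1) (cderiv_cst 1 z); rewrite subr0.
have [g [hg wg wE]] : exists g, [/\ holo g, cderiv (fun z => p z - 1) 0 (g 0) &
    forall z, p z - 1 = p 0 - 1 + z * g z].
  by apply: holo_factor => z /wd; exists (p1 z).
(* The derivative [- z * q2 z] of [p] vanishes at 0, so a second factor [z] splits off [p - 1]. *)
have g0 : g 0 = 0.
  by rewrite (cderiv_unique wg (wd 0 D0)) /p1 oppr0 mul0r.
have [h [hh _ gE]] := holo_factor hg.
have {g g0 hg wg gE} wE z : p z - 1 = z ^+ 2 * h z.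
  by rewrite wE gE g0 p0 subrr !add0r mulrA expr2.
have inside z : normc z < 1 -> normc (p z - 1) < 1.
  move=> z1; rewrite ltNge; apply/negP => pz.
  have [||w w1|z0 [z01 z00 wz0 win]] :=
      @first_exit _ (fun z => 1 - normc (p z - 1)) z z1.
  - by lra.
  - by rewrite p0 subrr normc0 subr0.
  - move=> e e0; have [t t0 ht] := ccont_normc (cderiv_cont (wd w w1)) e0.
    exists t => // u /ht; rewrite -normrN; congr (`|_| < _); lra.
  have n1 : normc (p z0 - 1) = 1 by lra.
  have [c c0 cE] : exists2 c : R, 0 <= c & z0 * p1 z0 = (p z0 - 1) * (2 + (c%:C)%C).
    apply: (jack_order2 hh wE z00 z01 n1 _ (wd z0 z01)) => u /win; lra.
  have [_ pz0] := qp z0 z01; have sz0 := starlike z0 z01.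
  have := posP z0 z01 z00; rewrite cE.
  have -> : (p z0 - 1) * (2 + (c%:C)%C) / p z0 = ((2 + c)%:C)%C * (1 - (p z0)^-1).
    by rewrite rmorphD/= rmorph_nat; field.
  (* The real part in [posP] becomes [(1 + alpha) * Re (s z0) + alpha * c / 2], which is at most 0
     for [alpha <= -1]. *)
  have half := Re_1_sub_inv pz0 n1.
  rewrite !ReD ReN [complex.Re (_ * s z0)]ReM ReD ImD /= add0r mul0r subr0.
  rewrite [complex.Re (alpha%:C%C * _)]ReM /= mul0r subr0.
  rewrite [complex.Re (_%:C%C * _)]ReM /= mul0r subr0 half.
  nra.
move=> z z1 z0; have [fE FE _] := rel z z1 z0; have [qz _] := qp z z1.
rewrite (_ : (z / f z) ^+ 2 * F z = p z); first exact: inside.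
by rewrite fE FE /p; field; rewrite qz z0.
Qed.

End AlphaConvex.

(** * The counterexample for [0 <= alpha <= 1] *)

Section SquareRootExample.
Variable R : realType.
Local Notation C := R[i].
Implicit Types (z w d : C).

Lemma Re_sqrtc_ge0 z : 0 <= complex.Re (sqrtc z).
Proof. by case: z => a b; exact: sqrtr_ge0. Qed.

Lemma Re_sqrtc_gt0 z : 0 < complex.Re z -> 0 < complex.Re (sqrtc z).
Proof.
case: z => a b /= a0; rewrite sqrtr_gt0 divr_gt0//.
by rewrite ltr_wpDl ?sqrtr_ge0.
Qed.

Definition sqrt_one_sub z : C := sqrtc (1 - z).

Lemma Re_one_sub_gt0 z : normc z < 1 -> 0 < complex.Re (1 - z).
Proof.
by move=> z1; rewrite ReD ReN /=; have := Re_le_normc z; rewrite ler_norml; lra.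
Qed.

Lemma Re_sqrt_one_sub_gt0 z : normc z < 1 -> 0 < complex.Re (sqrt_one_sub z).
Proof. by move=> z1; rewrite Re_sqrtc_gt0// Re_one_sub_gt0. Qed.

Lemma sqr_sqrt_one_sub z : sqrt_one_sub z ^+ 2 = 1 - z.
Proof. exact: sqr_sqrtc. Qed.

Lemma Re_gt0_neq0 z : 0 < complex.Re z -> z != 0.
Proof. by apply: contraTneq => ->; rewrite ltxx. Qed.

(** From [w - z = (a - b) * (b + a)] the remainder is exactly quadratic in [w - z]. Since the
    principal root has nonnegative real part everywhere, [normc (b + a)] is at least the real part
    of [a] for every [w]. *)
Lemma cderiv_sqrt_one_sub z : normc z < 1 ->
  cderiv sqrt_one_sub z (- (2 * sqrt_one_sub z)^-1).
Proof.
move=> z1 e e0; set a := sqrt_one_sub z.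
have a0 : 0 < complex.Re a by exact: Re_sqrt_one_sub_gt0.
have an0 : a != 0 by exact: Re_gt0_neq0.
have na : 0 < normc a by rewrite normc_gt0.
pose r := complex.Re a; pose K := 2 * normc a * r ^+ 2.
have K0 : 0 < K by rewrite !mulr_gt0// exprn_gt0.
exists (e * K) => [|w wz]; first by rewrite mulr_gt0.
set b := sqrt_one_sub w.
have rb : r <= normc (b + a).
  rewrite (le_trans _ (Re_le_normc _))// (le_trans _ (ler_norm _))// ReD.
  by rewrite lerDr Re_sqrtc_ge0.
have ba : b + a != 0 by rewrite -normc_gt0 (lt_le_trans a0).
have wzE : w - z = (a - b) * (b + a).
  rewrite (_ : (a - b) * (b + a) = a ^+ 2 - b ^+ 2); last by ring.
  by rewrite !sqr_sqrt_one_sub; ring.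
have -> : b - a - - (2 * a)^-1 * (w - z) =
    - ((w - z) * (w - z)) / (2 * a * (b + a) ^+ 2).
  by rewrite wzE; field; rewrite an0 ba.
rewrite !normcM normcV normcN !normcM (_ : normc 2 = 2); last first.
  by rewrite (_ : 2 = ((2 : R)%:C)%C :> C) ?normc_real ?ger0_norm// rmorph_nat.
have Kb : K <= 2 * normc a * (normc (b + a) * normc (b + a)).
  by rewrite /K expr2 ler_pM2l ?mulr_gt0// ler_pM// ltW.
rewrite ler_pdivrMr; last by apply: lt_le_trans K0 _.
rewrite mulrAC; apply: ler_wpM2r; first exact: normc_ge0.
by rewrite (le_trans (ltW wz))// ler_wpM2l// ltW.
Qed.

Lemma cderiv_inv_sqrt_one_sub z : normc z < 1 ->
  cderiv (fun w => (sqrt_one_sub w)^-1) z ((2 * sqrt_one_sub z ^+ 3)^-1).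
Proof.
move=> z1; have n0 := Re_gt0_neq0 (Re_sqrt_one_sub_gt0 z1).
by apply: cderiv_eq (cderivV n0 (cderiv_sqrt_one_sub z1)) _; field.
Qed.

Definition sqrt_example z : C := 2 * (1 - sqrt_one_sub z).

Lemma cderiv_sqrt_example z : normc z < 1 ->
  cderiv sqrt_example z ((sqrt_one_sub z)^-1).
Proof.
move=> z1; have n0 := Re_gt0_neq0 (Re_sqrt_one_sub_gt0 z1).
apply: cderiv_eq
  (cderivM (cderiv_cst 2 z) (cderivB (cderiv_cst 1 z) (cderiv_sqrt_one_sub z1))) _.
by rewrite /=; field.
Qed.

Lemma sqrt_one_sub_neq1 z : z != 0 -> 1 - sqrt_one_sub z != 0.
Proof.
apply: contra_neq => /eqP; rewrite subr_eq0 => /eqP u1.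
by have := sqr_sqrt_one_sub z; rewrite -u1 expr1n => /eqP;
  rewrite -subr_eq0 opprB addrC subrK => /eqP.
Qed.

Lemma Re_half z : complex.Re (1 / 2 + 1 / 2 * z) = 1 / 2 + 1 / 2 * complex.Re z.
Proof.
rewrite (_ : 1 / 2 = ((1 / 2 : R)%:C)%C :> C).
  by rewrite ReD ReM /= mul0r subr0.
by rewrite rmorphM fmorphV rmorph1 rmorph_nat.
Qed.

Lemma sqrt_example_alpha_convex (alpha : R) z : 0 <= alpha <= 1 -> normc z < 1 -> z != 0 ->
  0 < complex.Re ((1 - (alpha%:C)%C) * (z * (sqrt_one_sub z)^-1 / sqrt_example z) +
    (alpha%:C)%C * (1 + z * (2 * sqrt_one_sub z ^+ 3)^-1 / (sqrt_one_sub z)^-1)).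
Proof.
move=> a01 z1 z0; set u := sqrt_one_sub z.
have u0 : 0 < complex.Re u by exact: Re_sqrt_one_sub_gt0.
have un0 : u != 0 by exact: Re_gt0_neq0.
have u1 : 1 - u != 0 by exact: sqrt_one_sub_neq1.
(* The factorisation [z = (1 - u) * (1 + u)] cancels the factor [1 - u] of [sqrt_example]. *)
have zE : z = 1 - u ^+ 2 by rewrite sqr_sqrt_one_sub; ring.
have -> : z * u^-1 / sqrt_example z = 1 / 2 + 1 / 2 * u^-1.
  by rewrite /sqrt_example -/u zE; field; rewrite u1 un0.
have -> : 1 + z * (2 * u ^+ 3)^-1 / u^-1 = 1 / 2 + 1 / 2 * (1 - z)^-1.
  by rewrite zE (_ : 1 - (1 - u ^+ 2) = u ^+ 2); [field|ring].
rewrite (_ : 1 - (alpha%:C)%C = ((1 - alpha)%:C)%C); last by rewrite rmorphB rmorph1.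
rewrite ReD !ReM [complex.Re (1 / 2 + 1 / 2 * u^-1)]Re_half.
rewrite [complex.Re (1 / 2 + 1 / 2 * (1 - z)^-1)]Re_half /= !mul0r !subr0 !Re_inv.
have h1 : 0 < complex.Re u / normc u ^+ 2.
  by rewrite divr_gt0// exprn_gt0// normc_gt0.
have v0 := Re_one_sub_gt0 z1.
have h2 : 0 < complex.Re (1 - z) / normc (1 - z) ^+ 2.
  by rewrite divr_gt0// exprn_gt0// normc_gt0 Re_gt0_neq0.
nra.
Qed.

Lemma sqrt_example_not_U : exists z : C, [/\ normc z < 1, z != 0 &
  1 < normc ((z / sqrt_example z) ^+ 2 * (sqrt_one_sub z)^-1 - 1)].
Proof.
(* At [z = 99 / 100] the root is [1 / 10], and [(1 + v) ^+ 2 / (4 * v) - 1 = 81 / 40]. *)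
pose v : C := ((1 / 10 : R)%:C)%C; pose z := 1 - v ^+ 2.
have nz : normc z = 99 / 100.
  rewrite (_ : z = ((1 - (1 / 10) ^+ 2 : R)%:C)%C); last first.
    by rewrite rmorphB rmorph1 rmorphXn.
  by rewrite normc_real ger0_norm; lra.
have z1 : normc z < 1 by rewrite nz; lra.
exists z; split=> //; first by rewrite -normc_gt0 nz; lra.
have uE : sqrt_one_sub z = v.
  have := Re_sqrt_one_sub_gt0 z1; have := sqr_sqrt_one_sub z.
  rewrite (_ : 1 - z = v ^+ 2); last by rewrite /z; ring.
  move=> /eqP; rewrite eqf_sqr => /orP[/eqP //|/eqP ->].
  by rewrite ReN /v ltNge => /negP[] /=; lra.
have vE : v = 1 / 10 by rewrite /v rmorphM fmorphV rmorph1 rmorph_nat.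
rewrite /sqrt_example uE (_ : _ - 1 = ((81 / 40 : R)%:C)%C).
  by rewrite normc_real ger0_norm; lra.
by rewrite rmorphM fmorphV !rmorph_nat /z vE; field.
Qed.

End SquareRootExample.

(** * Translation between [cderiv] and the derivatives in the definitions *)

Section Bridge.
Variable R : realType.
Local Notation C := (Cplx R).

Lemma in_discE (z : C) : in_disc z <-> normc (z : R[i]) < 1.
Proof. by rewrite /in_disc -normc_lt. Qed.

Lemma analytic_cderiv (f : C -> C) (z : C) : analytic_in_disc f ->
  normc (z : R[i]) < 1 -> cderiv f z ('D_1 f z).
Proof. by move=> hf z1; apply/cderivP/derivableP/hf/in_discE. Qed.

Lemma derive_cderiv (f : C -> C) (z d : C) : cderiv f z d -> 'D_1 f z = d.
Proof. by move=> /cderivP [_ <-]. Qed.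

End Bridge.

Theorem theorem3 (R : realType) :
  (forall alpha : R, alpha <= -1 ->
     forall f : Cplx R -> Cplx R, alpha_convex alpha f -> classU f) /\
  (forall alpha : R, 0 <= alpha <= 1 ->
     exists f : Cplx R -> Cplx R, alpha_convex alpha f /\ ~ classU f).
Proof.
split=> alpha ha.
- move=> f [[hf [f0 df0]] [nz pos]]; split; first by split.
  have fF z : normc z < 1 -> cderiv f z ('D_1 f z) by exact: analytic_cderiv.
  have hfF : holo f by move=> z /fF; eexists; eassumption.
  (* A chosen derivative [F] agrees with ['D_1 f] only inside the disc, so differentiability is
     transferred on a disc of radius [1 - normc z] about [z]. *)
  have hF : holo ('D_1 f).
    have [F fF' hF] := holo_derivative hfF => z z1; have [d hd] := hF z z1.
    exists d; apply: (cderiv_near (f := F) (t := 1 - normc z)) hd; first by lra.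
    move=> w wz; apply: (cderiv_unique (fF' w _) (fF w _)); have := normc_lerB w z; lra.
  have FG z : normc z < 1 -> cderiv ('D_1 f) z ('D_1 ('D_1 f) z).
    by move=> /hF[d hd]; rewrite (derive_cderiv hd).
  have nz' z : normc z < 1 -> z != 0 -> f z != 0 /\ 'D_1 f z != 0.
    move=> /in_discE z1 z0; have := nz z z1 z0.
    by rewrite !mulf_eq0 !negb_or => /andP[/andP[]].
  move=> z /in_discE z1 z0; split; first by case: (nz' z z1 z0).
  rewrite -[1]/((1 : R)%:C)%C normc_lt.
  apply: (alpha_convex_bound ha fF FG) => //.
  + by move=> w w1 w0; case: (nz' w w1 w0).
  + by move=> w w1 w0; case: (nz' w w1 w0).
  + by move=> w /in_discE w1 w0; have := pos w w1 w0; rewrite -complexRe ltcR.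
- pose f : Cplx R -> Cplx R := @sqrt_example R.
  have fF (z : R[i]) : normc z < 1 -> 'D_1 f z = (sqrt_one_sub z)^-1.
    by move=> z1; apply/derive_cderiv/cderiv_sqrt_example.
  have fG (z : R[i]) : normc z < 1 -> 'D_1 ('D_1 f) z = (2 * sqrt_one_sub z ^+ 3)^-1.
    move=> z1; apply: derive_cderiv.
    apply: (cderiv_near (t := 1 - normc z)) (cderiv_inv_sqrt_one_sub z1); first by lra.
    by move=> w wz; rewrite fF//; have := normc_lerB w z; lra.
  have u0 : sqrt_one_sub (0 : R[i]) = 1 by rewrite /sqrt_one_sub subr0 sqrtc1.
  have fA : classA f.
    split.
      move=> z /in_discE z1.
      by have /cderivP[] := cderiv_sqrt_example z1.
    split; first by rewrite /f /sqrt_example u0 subrr mulr0.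
    by rewrite fF ?normc0// u0 invr1.
  exists f; split.
    split=> //; split=> z /in_discE z1 z0.
      have fz : f z != 0.
        by apply: mulf_neq0; [rewrite pnatr_eq0|exact: sqrt_one_sub_neq1].
      have uz := Re_gt0_neq0 (Re_sqrt_one_sub_gt0 z1).
      by rewrite fF// mulf_neq0 ?invr_eq0// mulf_neq0 ?invr_eq0.
    by rewrite -complexRe ltcR fF// fG//; exact: sqrt_example_alpha_convex.
  move=> [_ fU]; have [z [z1 z0]] := sqrt_example_not_U R.
  have /in_discE zD := z1; have [_] := fU z zD z0.
  rewrite fF// -[1 in X in X -> _]/((1 : R)%:C)%C normc_lt => h1 h2.
  by have := lt_trans h1 h2; rewrite ltxx.
Qed.
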